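(* Let $d$ be a prime and let $T:\mathcal{B}(\mathbb{C}^d)\to\mathcal{B}(\mathbb{C}^d)$ be a channel. Suppose that for some $0<\varepsilon<1/2$, $$\|\mathrm{id}-T\|_{cb}<2^{-H_2(\varepsilon)/\varepsilon}.$$ Then $$Q(T)\ge(1-4\varepsilon)\log_2 d-H_2(2\varepsilon),$$ where $H_2(r)=-r\log_2r-(1-r)\log_2(1-r)$.
   Context: A channel from input space $\mathcal{H}_1$ to output space $\mathcal{H}_2$ (finite dimensional) is a completely positive unital linear map $T:\mathcal{B}(\mathcal{H}_2)\to\mathcal{B}(\mathcal{H}_1)$. The cb-norm of a linear map $S:\mathcal{B}(\mathcal{K}_2)\to\mathcal{B}(\mathcal{K}_1)$ is $\|S\|_{cb}=\sup\{\|(S\otimes\mathrm{id}_{\mathcal{B}(\mathbb{C}^k)})(A)\|:k\in\mathbb{N},\ A\in\mathcal{B}(\mathcal{K}_2\otimes\mathbb{C}^k),\ \|A\|\le1\}$. For a positive integer $M$, $\Delta(T,M)=\inf_{E,D}\|ETD-\mathrm{id}_{\mathcal{B}(\mathcal{H}_0)}\|_{cb}$, with $\dim\mathcal{H}_0=M$ and the infimum over all channels $D:\mathcal{B}(\mathcal{H}_0)\to\mathcal{B}(\mathcal{H}_2)$ and $E:\mathcal{B}(\mathcal{H}_1)\to\mathcal{B}(\mathcal{H}_0)$. A number $c\ge0$ is an achievable rate if $\lim_{n\to\infty}\Delta(T^{\otimes n},\lfloor2^{cn}\rfloor)=0$, and the quantum capacity $Q(T)$ is the supremum of all achievable rates ($Q(T)=\infty$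 if every $c$ is achievable). *)

(* Defs.v *)
From HB Require Import structures.
From mathcomp Require Import all_boot all_order all_algebra.
From mathcomp Require Import all_classical all_reals all_analysis.
From mathcomp Require Import complex mxtens.
Set Implicit Arguments. Unset Strict Implicit. Unset Printing Implicit Defensive.
Import Order.TTheory GRing.Theory Num.Theory.
Local Open Scope ring_scope.
Local Open Scope classical_set_scope.

Section QC.
Variable R : realType.
Local Notation C := (R[i]).

Definition vnorm n (v : 'cV[C]_n) : R :=
  Num.sqrt (\sum_(i < n) (complex.Re (v i 0) ^+ 2 + complex.Im (v i 0) ^+ 2)).

Definition opnorm m n (A : 'M[C]_(m, n)) : \bar R :=
  ereal_sup [set (vnorm (A *m v))%:E | v in [set v : 'cV[C]_n | vnorm v <= 1]].

(* positive semidefinite: <v, A v> >= 0 for all v (order of the num. closed field C) *)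
Definition psd n (A : 'M[C]_n) : Prop :=
  forall v : 'cV[C]_n, 0 <= ((map_mx (@conjc R) v)^T *m A *m v) 0 0.

(* S (x) id_{B(C^k)}, where B(K (x) C^k) = 'M_(n * k) via mxtens_index *)
Definition amplL n2 n1 (S : 'M[C]_n2 -> 'M[C]_n1) k (A : 'M[C]_(n2 * k))
  : 'M[C]_(n1 * k) :=
  \matrix_(i, j)
    S (\matrix_(a, b) A (mxtens_index (a, (mxtens_unindex i).2))
                        (mxtens_index (b, (mxtens_unindex j).2)))
      (mxtens_unindex i).1 (mxtens_unindex j).1.

Definition amplR k n2 n1 (S : 'M[C]_n2 -> 'M[C]_n1) (A : 'M[C]_(k * n2))
  : 'M[C]_(k * n1) :=
  \matrix_(i, j)
    S (\matrix_(a, b) A (mxtens_index ((mxtens_unindex i).1, a))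
                        (mxtens_index ((mxtens_unindex j).1, b)))
      (mxtens_unindex i).2 (mxtens_unindex j).2.

Definition tensmap a2 a1 b2 b1 (S1 : 'M[C]_a2 -> 'M[C]_a1)
  (S2 : 'M[C]_b2 -> 'M[C]_b1) : 'M[C]_(a2 * b2) -> 'M[C]_(a1 * b1) :=
  fun A => amplL S1 (amplR S2 A).

Definition cbnorm n2 n1 (S : 'M[C]_n2 -> 'M[C]_n1) : \bar R :=
  ereal_sup [set x | exists (k : nat) (A : 'M[C]_(n2 * k)),
     (opnorm A <= 1%:E)%E /\ x = opnorm (amplL S A)].

(* channel (Heisenberg picture): completely positive unital linear map *)
Definition channel n2 n1 (T : 'M[C]_n2 -> 'M[C]_n1) : Prop :=
  linear T /\ T 1%:M = 1%:M /\
  forall k (A : 'M[C]_(n2 * k)), psd A -> psd (amplL T A).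

Fixpoint pw (d n : nat) : nat := if n is n'.+1 then (d * pw d n')%N else 1%N.

Fixpoint tpow d (T : 'M[C]_d -> 'M[C]_d) (n : nat)
  : 'M[C]_(pw d n) -> 'M[C]_(pw d n) :=
  match n as n0 return 'M[C]_(pw d n0) -> 'M[C]_(pw d n0) with
  | 0 => id
  | n'.+1 => tensmap T (@tpow d T n')
  end.

Definition Delta n2 n1 (T : 'M[C]_n2 -> 'M[C]_n1) (M : nat) : \bar R :=
  ereal_inf [set cbnorm (fun X => E (T (D X)) - X) |
     E in [set E : 'M[C]_n1 -> 'M[C]_M | channel E] &
     D in [set D : 'M[C]_M -> 'M[C]_n2 | channel D]].

Definition achievable d (T : 'M[C]_d -> 'M[C]_d) (c : R) : Prop :=
  0 <= c /\
  (fun n : nat => Delta (@tpow d T n) (Num.truncn (2 `^ (c * n%:R)))) @ \oo --> 0%E.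

Definition Qcap d (T : 'M[C]_d -> 'M[C]_d) : \bar R :=
  ereal_sup [set c%:E | c in [set c : R | achievable T c]].

Definition log2 (x : R) : R := ln x / ln 2.

Definition H2 (r : R) : R := - r * log2 r - (1 - r) * log2 (1 - r).

End QC.

(* Main.v *)
Require Import Defs.
From HB Require Import structures.
From mathcomp Require Import all_boot all_order all_algebra.
From mathcomp Require Import all_classical all_reals all_analysis.
From mathcomp Require Import complex mxtens.
From mathcomp Require Import ring lra.
Import Order.TTheory GRing.Theory Num.Theory Normc.
Local Open Scope ring_scope.
Set Implicit Arguments. Unset Strict Implicit. Unset Printing Implicit Defensive.

(** Quantum Gilbert-Varshamov bound with random graph codes. Write [L = T - id]
and expand the n-th tensor power of [T = id + L] according to the number [j] of
factors [L]. A term with [j] factors has the form [A |-> sum K^* A K'] with [K],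
[K'] acting on at most [j] sites, and for [j > 0] it kills the identity; a code
correcting [f] errors therefore annihilates all the terms with [0 < j <= f]
exactly, and leaves [id] for [j = 0]. The remaining terms have cb-norm at most
[sum_(j > f) C(n, j) delta^j], where [delta = ||T - id||_cb]. With
[f = floor(eps n)] and
[delta0 = 2^(- H2 eps / eps) = eps (1 - eps)^((1 - eps) / eps)] one has
[delta0^j <= eps^j (1 - eps)^(n - j)] for [j >= eps n], so the tail is at most
[(delta / delta0)^(f + 1)], which tends to [0].

Codes come from a quadratic form [Q z = z G z^T] over [F_d]: the code words are
[sum_y chi (Q (x, y)) |y>]. A Pauli operator with shift [a] and phase [b] has
nonzero matrix element between the words [x] and [x'] only if [b] is the output
part of [(x' - x, a) (G + G^T)]. For [(x' - x, a) <> 0] a random [G] satisfies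
this with probability at most [d^(1 - n)], so a good [G] exists as soon as [d^k]
times the number of Pauli operators of weight at most [2 f], itself at most
[d^(4 eps n) 2^(n H2(2 eps))], is smaller than [d^(n - 1)]. *)

(** * Tensor products *)

Lemma mxtens_index_bij m n : bijective (@mxtens_index m n).
Proof. exact: Bijective (@mxtens_indexK m n) (@mxtens_unindexK m n). Qed.

Lemma mxtens_unindex_bij m n : bijective (@mxtens_unindex m n).
Proof. exact: Bijective (@mxtens_unindexK m n) (@mxtens_indexK m n). Qed.

Lemma mxtens_unindex_pairK m n (x : 'I_(m * n)) :
  mxtens_index ((mxtens_unindex x).1, (mxtens_unindex x).2) = x.
Proof. by rewrite -surjective_pairing mxtens_unindexK. Qed.

Lemma eq_mxtens (V : Type) m1 m2 n1 n2 (A B : 'M[V]_(m1 * m2, n1 * n2)) :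
  (forall i1 i2 j1 j2, A (mxtens_index (i1, i2)) (mxtens_index (j1, j2)) =
                       B (mxtens_index (i1, i2)) (mxtens_index (j1, j2))) ->
  A = B.
Proof.
move=> AB; apply/matrixP => i j; case: (mxtens_indexP i) => i1 i2.
by case: (mxtens_indexP j) => j1 j2.
Qed.

Lemma delta_mx_tens (K : nzRingType) m1 m2 n1 n2
    (i1 : 'I_m1) (i2 : 'I_m2) (j1 : 'I_n1) (j2 : 'I_n2) :
  delta_mx (mxtens_index (i1, i2)) (mxtens_index (j1, j2)) =
  delta_mx i1 j1 *t delta_mx i2 j2 :> 'M[K]_(m1 * m2, n1 * n2).
Proof.
apply: eq_mxtens => k1 k2 l1 l2; rewrite tensmxE !mxE.
rewrite !(can_eq (@mxtens_indexK _ _)) !xpair_eqE -natrM mulnb.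
by rewrite andbACA.
Qed.

Lemma tensmx11 (K : nzRingType) m n :
  (1%:M : 'M[K]_m) *t (1%:M : 'M[K]_n) = 1%:M.
Proof.
apply: eq_mxtens => i1 i2 j1 j2; rewrite tensmxE !mxE.
by rewrite (can_eq (@mxtens_indexK m n)) xpair_eqE -natrM mulnb.
Qed.

Definition tensmxr (K : pzRingType) m n p q (B : 'M[K]_(p, q)) (A : 'M[K]_(m, n)) :=
  A *t B.

Section TensorLinear.
Variables (K : comNzRingType) (m n p q : nat).

Fact tensmx_is_linear (A : 'M[K]_(m, n)) : linear (@tensmx K m n p q A).
Proof. by move=> c B B'; apply/matrixP => i j; rewrite !mxE mulrDr mulrCA. Qed.

HB.instance Definition _ (A : 'M[K]_(m, n)) :=
  GRing.isLinear.Build K _ _ _ (@tensmx K m n p q A) (tensmx_is_linear A).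

Fact tensmxr_is_linear (B : 'M[K]_(p, q)) : linear (@tensmxr K m n p q B).
Proof. by move=> c A A'; apply/matrixP => i j; rewrite !mxE mulrDl mulrA. Qed.

HB.instance Definition _ (B : 'M[K]_(p, q)) :=
  GRing.isLinear.Build K _ _ _ (@tensmxr K m n p q B) (tensmxr_is_linear B).

End TensorLinear.

Lemma eq_linear_tens (K : nzRingType) (V : lmodType K) m1 m2 n1 n2
    (f g : {linear 'M[K]_(m1 * m2, n1 * n2) -> V}) :
  (forall A B, f (A *t B) = g (A *t B)) -> f =1 g.
Proof.
move=> fg A; rewrite (matrix_sum_delta A) !linear_sum; apply: eq_bigr => i _.
rewrite !linear_sum; apply: eq_bigr => j _; rewrite !linearZ; congr (_ *: _).
case: (mxtens_indexP i) => i1 i2; case: (mxtens_indexP j) => j1 j2.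
by rewrite delta_mx_tens.
Qed.

Lemma mul_delta_mx_delta (K : comNzRingType) m n p q (A : 'M[K]_(n, p))
    (k : 'I_m) i j (l : 'I_q) :
  delta_mx k i *m A *m delta_mx j l = A i j *: delta_mx k l.
Proof.
have mul_row_col : delta_mx 0 i *m (A *m delta_mx j 0) = (A i j)%:M :> 'M[K]_1.
  by rewrite mulmxA -rowE -colE [LHS]mx11_scalar !mxE.
rewrite -(mul_delta_mx (0 : 'I_1) k i) -(mul_delta_mx (0 : 'I_1) j l) -!mulmxA.
rewrite (mulmxA A) (mulmxA (delta_mx 0 i)) mul_row_col mul_scalar_mx.
by rewrite -scalemxAr mul_delta_mx.
Qed.

Section Ampliation.
Variable R : realType.
Local Notation C := (R[i]).

Lemma amplLE n2 n1 (S : 'M[C]_n2 -> 'M[C]_n1) k (A : 'M[C]_(n2 * k)) i1 i2 j1 j2 :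
  amplL S A (mxtens_index (i1, i2)) (mxtens_index (j1, j2)) =
  S (\matrix_(a, b) A (mxtens_index (a, i2)) (mxtens_index (b, j2))) i1 j1.
Proof. by rewrite /amplL mxE !mxtens_indexK. Qed.

Lemma amplRE k n2 n1 (S : 'M[C]_n2 -> 'M[C]_n1) (A : 'M[C]_(k * n2)) i1 i2 j1 j2 :
  amplR S A (mxtens_index (i1, i2)) (mxtens_index (j1, j2)) =
  S (\matrix_(a, b) A (mxtens_index (i1, a)) (mxtens_index (j1, b))) i2 j2.
Proof. by rewrite /amplR mxE !mxtens_indexK. Qed.

Lemma eq_amplL n2 n1 (S S' : 'M[C]_n2 -> 'M[C]_n1) k :
  S =1 S' -> @amplL R n2 n1 S k =1 amplL S' (k := k).
Proof. by move=> SS' A; apply/matrixP => i j; rewrite !mxE SS'. Qed.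

Lemma eq_amplR k n2 n1 (S S' : 'M[C]_n2 -> 'M[C]_n1) :
  S =1 S' -> @amplR R k n2 n1 S =1 amplR S'.
Proof. by move=> SS' A; apply/matrixP => i j; rewrite !mxE SS'. Qed.

Lemma eq_tensmap a2 a1 b2 b1 (S1 S1' : 'M[C]_a2 -> 'M[C]_a1)
    (S2 S2' : 'M[C]_b2 -> 'M[C]_b1) :
  S1 =1 S1' -> S2 =1 S2' -> tensmap S1 S2 =1 tensmap S1' S2'.
Proof. by move=> S11' S22' A; rewrite /tensmap (eq_amplL S11') (eq_amplR S22'). Qed.

Section LinearAmpliation.
Variables (n2 n1 : nat) (S : {linear 'M[C]_n2 -> 'M[C]_n1}) (k : nat).

Fact amplL_is_linear : linear (@amplL R n2 n1 S k).
Proof.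
move=> c A B; apply: eq_mxtens => i1 i2 j1 j2.
rewrite [RHS]mxE [(c *: amplL S A) _ _]mxE !amplLE.
have -> : \matrix_(a, b) (c *: A + B) (mxtens_index (a, i2)) (mxtens_index (b, j2)) =
    c *: \matrix_(a, b) A (mxtens_index (a, i2)) (mxtens_index (b, j2)) +
    \matrix_(a, b) B (mxtens_index (a, i2)) (mxtens_index (b, j2)).
  by apply/matrixP => a b; rewrite !mxE.
by rewrite linearP !mxE.
Qed.

HB.instance Definition _ :=
  GRing.isLinear.Build C _ _ _ (@amplL R n2 n1 S k) amplL_is_linear.

Fact amplR_is_linear : linear (@amplR R k n2 n1 S).
Proof.
move=> c A B; apply: eq_mxtens => i1 i2 j1 j2.
rewrite [RHS]mxE [(c *: amplR S A) _ _]mxE !amplRE.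
have -> : \matrix_(a, b) (c *: A + B) (mxtens_index (i1, a)) (mxtens_index (j1, b)) =
    c *: \matrix_(a, b) A (mxtens_index (i1, a)) (mxtens_index (j1, b)) +
    \matrix_(a, b) B (mxtens_index (i1, a)) (mxtens_index (j1, b)).
  by apply/matrixP => a b; rewrite !mxE.
by rewrite linearP !mxE.
Qed.

HB.instance Definition _ :=
  GRing.isLinear.Build C _ _ _ (@amplR R k n2 n1 S) amplR_is_linear.

Lemma amplL_tens A (B : 'M[C]_k) : amplL S (A *t B) = S A *t B.
Proof.
apply: eq_mxtens => i1 i2 j1 j2; rewrite amplLE tensmxE.
rewrite (_ : \matrix_(a, b) _ = B i2 j2 *: A); first by rewrite linearZ mxE mulrC.
by apply/matrixP => a b; rewrite mxE tensmxE mxE mulrC.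
Qed.

Lemma amplR_tens (A : 'M[C]_k) B : amplR S (A *t B) = A *t S B.
Proof.
apply: eq_mxtens => i1 i2 j1 j2; rewrite amplRE tensmxE.
rewrite (_ : \matrix_(a, b) _ = A i1 j1 *: B); first by rewrite linearZ mxE.
by apply/matrixP => a b; rewrite mxE tensmxE mxE.
Qed.

End LinearAmpliation.

Section LinearTensor.
Variables (a2 a1 b2 b1 : nat).
Variables (S1 : {linear 'M[C]_a2 -> 'M[C]_a1}) (S2 : {linear 'M[C]_b2 -> 'M[C]_b1}).

HB.instance Definition _ :=
  GRing.Linear.copy (tensmap S1 S2) (@amplL R a2 a1 S1 b1 \o @amplR R a2 b2 b1 S2).

Lemma tensmap_tens A B : tensmap S1 S2 (A *t B) = S1 A *t S2 B.
Proof. by rewrite /tensmap amplR_tens amplL_tens. Qed.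

End LinearTensor.

Lemma tensmap_id a b : tensmap (@idfun 'M[C]_a) (@idfun 'M[C]_b) =1 id.
Proof. by move=> A; apply: eq_mxtens => i1 i2 j1 j2; rewrite amplLE mxE amplRE mxE. Qed.

Lemma tensmapDl a2 a1 b2 b1 (S1 S1' : 'M[C]_a2 -> 'M[C]_a1)
    (S2 : 'M[C]_b2 -> 'M[C]_b1) A :
  tensmap (S1 \+ S1') S2 A = tensmap S1 S2 A + tensmap S1' S2 A.
Proof. by apply/matrixP => i j; rewrite !mxE. Qed.

Lemma tensmap_sumr a2 a1 b2 b1 (J : finType) (S1 : {linear 'M[C]_a2 -> 'M[C]_a1})
    (S2 : J -> 'M[C]_b2 -> 'M[C]_b1) A :
  tensmap S1 (fun X => \sum_j S2 j X) A = \sum_j tensmap S1 (S2 j) A.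
Proof.
rewrite /tensmap -linear_sum; congr amplL; apply/matrixP => i j.
by rewrite !mxE !summxE; apply: eq_bigr => l _; rewrite mxE.
Qed.

Lemma tensmap0r a2 a1 b2 b1 (S1 : {linear 'M[C]_a2 -> 'M[C]_a1})
    (S2 : 'M[C]_b2 -> 'M[C]_b1) A :
  S2 =1 (fun=> 0) -> tensmap S1 S2 A = 0.
Proof.
move=> S2_0; rewrite /tensmap (_ : amplR S2 A = 0) ?linear0 //.
by apply/matrixP => i j; rewrite mxE S2_0 !mxE.
Qed.

End Ampliation.

(** * Completely bounded maps *)

Section L2Norm.
Variable R : rcfType.
Local Notation C := (R[i]).

Lemma sqr_normcE (z : C) : normc z ^+ 2 = complex.Re z ^+ 2 + complex.Im z ^+ 2.
Proof. by case: z => a b; rewrite sqr_sqrtr // addr_ge0 ?sqr_ge0. Qed.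

Lemma normc_real (r : R) : normc r%:C%C = `|r|.
Proof. by rewrite /= expr0n addr0 sqrtr_sqr. Qed.

Lemma normc_ge0 (z : C) : 0 <= normc z.
Proof. by case: z => a b; exact: sqrtr_ge0. Qed.

Definition l2norm (I : finType) (v : I -> C) : R :=
  Num.sqrt (\sum_i normc (v i) ^+ 2).

Section Theory.
Variable I : finType.
Implicit Types v w : I -> C.

Lemma sqr_l2norm v : l2norm v ^+ 2 = \sum_i normc (v i) ^+ 2.
Proof. by rewrite sqr_sqrtr //; apply: sumr_ge0 => i _; exact: sqr_ge0. Qed.

Lemma l2norm_ge0 v : 0 <= l2norm v.
Proof. exact: sqrtr_ge0. Qed.

Lemma eq_l2norm v w : v =1 w -> l2norm v = l2norm w.
Proof. by move=> vw; congr Num.sqrt; apply: eq_bigr => i _; rewrite vw. Qed.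

Lemma l2norm0 : l2norm (fun _ : I => 0) = 0.
Proof. by rewrite /l2norm big1 ?sqrtr0 // => i _; rewrite normc0 expr0n. Qed.

Lemma l2norm_eq0 v : l2norm v = 0 -> v =1 (fun=> 0).
Proof.
move=> v0 i; have /eqP := sqr_l2norm v; rewrite v0 expr0n eq_sym psumr_eq0.
  by move=> /allP/(_ i (mem_index_enum i)); rewrite sqrf_eq0 => /eqP/eq0_normc.
by move=> j _; exact: sqr_ge0.
Qed.

Lemma l2normZ c v : l2norm (fun i => c * v i) = normc c * l2norm v.
Proof.
rewrite -[normc c]ger0_norm ?normc_ge0 // -sqrtr_sqr -sqrtrM ?sqr_ge0 // mulr_sumr.
by congr Num.sqrt; apply: eq_bigr => i _; rewrite normcM exprMn.
Qed.

Lemma ler_l2normD v w : l2norm (fun i => v i + w i) <= l2norm v + l2norm w.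
Proof.
pose row (u : I -> C) : 'rV[C]_#|I| := \row_k u (enum_val k).
have l2norm_dotmx u : (l2norm u)%:C%C = sqrtC (dotmx (row u) (row u)).
  rewrite dotmxE mxE -[LHS]sqrCK ?lecR ?l2norm_ge0 // -rmorphXn sqr_l2norm.
  rewrite rmorph_sum (reindex (@enum_val I I)) /=; last first.
    exact/onW_bij/enum_val_bij.
  congr sqrtC; apply: eq_bigr => k _; rewrite !mxE -normCK normc_def -rmorphXn /=.
  by rewrite sqr_normcE sqr_sqrtr // addr_ge0 ?sqr_ge0.
rewrite -lecR rmorphD /= !l2norm_dotmx.
have -> : row (fun i => v i + w i) = row v + row w by apply/rowP => k; rewrite !mxE.
exact: triangle_lerif.
Qed.

End Theory.

Lemma l2norm_reindex (I J : finType) (h : I -> J) (v : J -> C) :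
  bijective h -> l2norm (fun i => v (h i)) = l2norm v.
Proof. by move=> bij_h; rewrite /l2norm (reindex h) //; exact: onW_bij. Qed.

(* Matrices are indexed by arbitrary finite types: regrouping tensor factors
   then is a mere reindexing. *)
Definition matvec (I J : finType) (A : I -> J -> C) (v : J -> C) : I -> C :=
  fun i => \sum_j A i j * v j.

Definition opnorm_le (I J : finType) (A : I -> J -> C) (r : R) : Prop :=
  forall v : J -> C, l2norm (matvec A v) <= r * l2norm v.

Section OperatorNorm.
Variables I J : finType.
Implicit Types (A B : I -> J -> C) (v : J -> C) (c : C) (r s : R).

Lemma matvec0 v : matvec (fun (_ : I) (_ : J) => 0) v =1 (fun=> 0).
Proof. by move=> i; rewrite /matvec big1 // => j _; rewrite mul0r. Qed.

Lemma matvecDl A B v :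
  matvec (fun i j => A i j + B i j) v =1 (fun i => matvec A v i + matvec B v i).
Proof. by move=> i; rewrite -big_split; apply: eq_bigr => j _; rewrite mulrDl. Qed.

Lemma matvecZl c A v :
  matvec (fun i j => c * A i j) v =1 (fun i => c * matvec A v i).
Proof. by move=> i; rewrite mulr_sumr; apply: eq_bigr => j _; rewrite mulrA. Qed.

Lemma matvecZr c A v : matvec A (fun j => c * v j) =1 (fun i => c * matvec A v i).
Proof. by move=> i; rewrite mulr_sumr; apply: eq_bigr => j _; rewrite mulrCA. Qed.

Lemma eq_opnorm_le A B r :
  (forall i j, A i j = B i j) -> opnorm_le A r -> opnorm_le B r.
Proof.
move=> AB leA v; rewrite -(@eq_l2norm _ (matvec A v)) // => i.
by apply: eq_bigr => j _; rewrite AB.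
Qed.

Lemma opnorm_le0 : opnorm_le (fun (_ : I) (_ : J) => 0) 0.
Proof. by move=> v; rewrite mul0r (eq_l2norm (matvec0 v)) l2norm0. Qed.

Lemma opnorm_leD A B r s :
  opnorm_le A r -> opnorm_le B s -> opnorm_le (fun i j => A i j + B i j) (r + s).
Proof.
move=> leA leB v; rewrite (eq_l2norm (matvecDl A B v)) mulrDl.
exact: le_trans (ler_l2normD _ _) (lerD (leA v) (leB v)).
Qed.

Lemma opnorm_leZ c A r :
  opnorm_le A r -> opnorm_le (fun i j => c * A i j) (normc c * r).
Proof.
move=> leA v; rewrite (eq_l2norm (matvecZl c A v)) l2normZ -mulrA.
by rewrite ler_wpM2l ?normc_ge0.
Qed.

Lemma opnorm_leN A r : opnorm_le A r -> opnorm_le (fun i j => - A i j) r.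
Proof.
move/(opnorm_leZ (-1)); rewrite normcN normc1 mul1r.
by apply: eq_opnorm_le => i j; rewrite mulN1r.
Qed.

Lemma opnorm_le0_eq0 A : opnorm_le A 0 -> forall i j, A i j = 0.
Proof.
move=> leA i j; have := leA (fun j' => (j' == j)%:R); rewrite mul0r => le0.
have /(_ i) : matvec A (fun j' => (j' == j)%:R) =1 (fun=> 0).
  by apply/l2norm_eq0/le_anti; rewrite le0 l2norm_ge0.
rewrite /matvec (bigD1 j) //= eqxx mulr1 big1 ?addr0 // => j' /negbTE ->.
by rewrite mulr0.
Qed.

Lemma opnorm_le_reindex (I' J' : finType) (g : I' -> I) (h : J' -> J) A r :
    bijective g -> bijective h ->
  opnorm_le A r -> opnorm_le (fun i j => A (g i) (h j)) r.
Proof.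
move=> bij_g [h' hK h'K] leA v; have := leA (fun j => v (h' j)).
rewrite (@l2norm_reindex _ _ h'); last by exists h.
rewrite -(l2norm_reindex (matvec A _) bij_g).
congr (_ <= _); apply: eq_l2norm => i; rewrite /matvec (reindex h).
  by apply: eq_bigr => j _; rewrite hK.
by exists h' => j _; rewrite ?hK ?h'K.
Qed.

End OperatorNorm.

Definition ampl n2 n1 (S : 'M[C]_n2 -> 'M[C]_n1) (K : finType)
    (A : 'I_n2 * K -> 'I_n2 * K -> C) : 'I_n1 * K -> 'I_n1 * K -> C :=
  fun i j => S (\matrix_(a, b) A (a, i.2) (b, j.2)) i.1 j.1.

Definition cbnorm_le n2 n1 (S : 'M[C]_n2 -> 'M[C]_n1) (r : R) : Prop :=
  forall (K : finType) (A : 'I_n2 * K -> 'I_n2 * K -> C) (s : R),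
    0 <= s -> opnorm_le A s -> opnorm_le (ampl S A) (r * s).

Section CbNorm.
Variables n2 n1 : nat.
Implicit Types S : 'M[C]_n2 -> 'M[C]_n1.

Lemma eq_cbnorm_le S S' r : S =1 S' -> cbnorm_le S r -> cbnorm_le S' r.
Proof.
move=> SS' leS K A s s0 leA; apply: eq_opnorm_le (leS K A s s0 leA) => i j.
by rewrite /ampl SS'.
Qed.

Lemma cbnorm_le0 : cbnorm_le (fun _ : 'M[C]_n2 => (0 : 'M[C]_n1)) 0.
Proof.
move=> K A s _ _; rewrite mul0r; apply: eq_opnorm_le (@opnorm_le0 _ _) => i j.
by rewrite /ampl mxE.
Qed.

Lemma cbnorm_leD S S' r r' :
  cbnorm_le S r -> cbnorm_le S' r' -> cbnorm_le (S \+ S') (r + r').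
Proof.
move=> leS leS' K A s s0 leA; rewrite mulrDl.
apply: eq_opnorm_le (opnorm_leD (leS K A s s0 leA) (leS' K A s s0 leA)) => i j.
by rewrite /ampl mxE.
Qed.

Lemma cbnorm_leN S r : cbnorm_le S r -> cbnorm_le (fun X => - S X) r.
Proof.
move=> leS K A s s0 leA; apply: eq_opnorm_le (opnorm_leN (leS K A s s0 leA)) => i j.
by rewrite /ampl mxE.
Qed.

Lemma cbnorm_le_sum (J : Type) (r : seq J) (P : pred J)
    (S : J -> 'M[C]_n2 -> 'M[C]_n1) (b : J -> R) :
  (forall j, P j -> cbnorm_le (S j) (b j)) ->
  cbnorm_le (fun X => \sum_(j <- r | P j) S j X) (\sum_(j <- r | P j) b j).
Proof.
move=> leS; elim: r => [|j r leSr].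
  by rewrite big_nil; apply: eq_cbnorm_le cbnorm_le0 => X; rewrite big_nil.
rewrite big_cons; case: ifP => Pj.
  by apply: eq_cbnorm_le (cbnorm_leD (leS j Pj) leSr) => X; rewrite big_cons Pj.
by apply: eq_cbnorm_le leSr => X; rewrite big_cons Pj.
Qed.

End CbNorm.

Lemma cbnorm_le_id n : cbnorm_le (@idfun 'M[C]_n) 1.
Proof.
move=> K A s s0 leA; rewrite mul1r; apply: eq_opnorm_le leA => -[i k] [j l].
by rewrite /ampl mxE.
Qed.

Lemma cbnorm_le_comp n3 n2 n1 (S : 'M[C]_n2 -> 'M[C]_n1)
    (S' : 'M[C]_n3 -> 'M[C]_n2) (r r' : R) :
  0 <= r' -> cbnorm_le S r -> cbnorm_le S' r' -> cbnorm_le (S \o S') (r * r').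
Proof.
move=> r'0 leS leS' K A s s0 leA; rewrite -mulrA.
apply: eq_opnorm_le (leS K _ _ _ (leS' K A s s0 leA)); last exact: mulr_ge0.
move=> i j; rewrite /ampl /=; congr (S _ _ _).
by apply/matrixP => a b; rewrite mxE.
Qed.

End L2Norm.

Section Norms.
Variable R : realType.
Local Notation C := (R[i]).

Lemma vnormE n (v : 'cV[C]_n) : vnorm v = l2norm (fun i => v i 0).
Proof. by congr Num.sqrt; apply: eq_bigr => i _; rewrite sqr_normcE. Qed.

Lemma vnorm_mulmxE m n (A : 'M[C]_(m, n)) v :
  vnorm (A *m v) = l2norm (matvec A (fun j => v j 0)).
Proof. by rewrite vnormE; apply: eq_l2norm => i; rewrite mxE. Qed.

Lemma vnorm_col n (v : 'I_n -> C) : vnorm (\col_j v j) = l2norm v.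
Proof. by rewrite vnormE; apply: eq_l2norm => j; rewrite mxE. Qed.

Lemma vnorm_mul_col m n (A : 'M[C]_(m, n)) (v : 'I_n -> C) :
  vnorm (A *m \col_j v j) = l2norm (matvec A v).
Proof.
rewrite vnorm_mulmxE; apply: eq_l2norm => i.
by apply: eq_bigr => j _; rewrite mxE.
Qed.

Lemma opnorm_le_mxP m n (A : 'M[C]_(m, n)) (r : R) :
  opnorm_le A r <-> forall v : 'cV_n, vnorm (A *m v) <= r * vnorm v.
Proof.
split=> [leA v|leA v]; first by rewrite vnorm_mulmxE vnormE; exact: leA.
by rewrite -vnorm_mul_col -vnorm_col; exact: leA.
Qed.

Lemma opnorm_leP m n (A : 'M[C]_(m, n)) (r : R) : 0 <= r ->
  (opnorm A <= r%:E)%E <-> opnorm_le A r.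
Proof.
move=> r0; split=> [le_A_r v|/opnorm_le_mxP leA]; last first.
  apply: ge_ereal_sup => _ [v /= v1 <-]; rewrite lee_fin.
  by apply: le_trans (leA v) _; rewrite ler_piMr.
pose c : C := ((l2norm v)^-1)%:C%C.
have normc_c : normc c = (l2norm v)^-1.
  by rewrite normc_real ger0_norm // invr_ge0 l2norm_ge0.
have [v0|v_neq0] := eqVneq (l2norm v) 0.
  rewrite v0 mulr0 (@eq_l2norm _ _ _ (fun=> 0)) ?l2norm0 // => i.
  by rewrite /matvec big1 // => j _; rewrite (l2norm_eq0 v0) mulr0.
have : ((vnorm (A *m \col_j (c * v j)))%:E <= r%:E)%E.
  apply: le_trans le_A_r; apply: ereal_sup_ubound; exists (\col_j (c * v j)) => //=.
  by rewrite vnorm_col l2normZ normc_c mulVf.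
rewrite lee_fin vnorm_mul_col (eq_l2norm (matvecZr c A v)) l2normZ normc_c mulrC.
by rewrite ler_pdivrMr // lt_def v_neq0 l2norm_ge0.
Qed.

Lemma opnorm_le_amplL n2 n1 (S : 'M[C]_n2 -> 'M[C]_n1) (r s : R) k
    (A : 'M[C]_(n2 * k)) :
  0 <= s -> cbnorm_le S r -> opnorm_le A s -> opnorm_le (amplL S A) (r * s).
Proof.
move=> s0 leS leA.
have bij := mxtens_index_bij n2 k; have bij' := mxtens_unindex_bij n1 k.
have leSA := leS _ _ _ s0 (opnorm_le_reindex bij bij leA).
apply: eq_opnorm_le (opnorm_le_reindex bij' bij' leSA).
by move=> i j; rewrite /ampl /amplL mxE.
Qed.

Lemma cbnorm_le_amplL n2 n1 (S : 'M[C]_n2 -> 'M[C]_n1) r :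
  (forall k (A : 'M[C]_(n2 * k)) s,
    0 <= s -> opnorm_le A s -> opnorm_le (amplL S A) (r * s)) ->
  cbnorm_le S r.
Proof.
move=> leS K A s s0 leA.
pose dec n (x : 'I_(n * #|K|)) : 'I_n * K :=
  ((mxtens_unindex x).1, enum_val (mxtens_unindex x).2).
pose enc n (y : 'I_n * K) : 'I_(n * #|K|) := mxtens_index (y.1, enum_rank y.2).
have encK n : cancel (@enc n) (@dec n).
  by case=> i k; rewrite /dec /enc mxtens_indexK /= enum_rankK.
have decK n : cancel (@dec n) (@enc n).
  by move=> x; rewrite /dec /enc enum_valK mxtens_unindex_pairK.
have bij_dec : bijective (@dec n2) by exists (@enc n2).
have bij_enc : bijective (@enc n1) by exists (@dec n1).
pose B : 'M[C]_(n2 * #|K|) := \matrix_(i, j) A (dec n2 i) (dec n2 j).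
have leB : opnorm_le B s.
  by apply: eq_opnorm_le (opnorm_le_reindex bij_dec bij_dec leA) => i j; rewrite mxE.
apply: eq_opnorm_le (opnorm_le_reindex bij_enc bij_enc (leS _ B s s0 leB)) => i j.
rewrite /amplL /ampl mxE !mxtens_indexK; congr (S _ _ _).
by apply/matrixP => a b; rewrite !mxE /dec !mxtens_indexK !enum_rankK.
Qed.

Lemma cbnorm_le_tensmap a2 a1 b2 b1 (S1 : 'M[C]_a2 -> 'M[C]_a1)
    (S2 : 'M[C]_b2 -> 'M[C]_b1) (r1 r2 : R) :
  0 <= r2 -> cbnorm_le S1 r1 -> cbnorm_le S2 r2 ->
  cbnorm_le (tensmap S1 S2) (r1 * r2).
Proof.
move=> r2_ge0 leS1 leS2 K A s s0 leA; rewrite -mulrA.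
pose to_second (x : 'I_b2 * ('I_a2 * K)) : 'I_(a2 * b2) * K :=
  (mxtens_index (x.2.1, x.1), x.2.2).
have bij_to_second : bijective to_second.
  exists (fun y => ((mxtens_unindex y.1).2, ((mxtens_unindex y.1).1, y.2))).
    by case=> i [j k]; rewrite /to_second mxtens_indexK.
  by case=> i k; rewrite /to_second mxtens_unindex_pairK.
pose swap (x : 'I_a2 * ('I_b1 * K)) : 'I_b1 * ('I_a2 * K) := (x.2.1, (x.1, x.2.2)).
have bij_swap : bijective swap.
  by exists (fun y => (y.2.1, (y.1, y.2.2))) => [] [x [y z]].
pose from_first (x : 'I_(a1 * b1) * K) : 'I_a1 * ('I_b1 * K) :=
  ((mxtens_unindex x.1).1, ((mxtens_unindex x.1).2, x.2)).
have bij_from_first : bijective from_first.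
  exists (fun y => (mxtens_index (y.1, y.2.1), y.2.2)).
    by case=> i k; rewrite /from_first mxtens_unindex_pairK.
  by case=> i [j k]; rewrite /from_first mxtens_indexK.
have leS2A := leS2 _ _ _ s0 (opnorm_le_reindex bij_to_second bij_to_second leA).
have := leS1 _ _ _ (mulr_ge0 r2_ge0 s0) (opnorm_le_reindex bij_swap bij_swap leS2A).
move=> /(opnorm_le_reindex bij_from_first bij_from_first); apply: eq_opnorm_le => i j.
rewrite /ampl mxE; congr (S1 _ _ _); apply/matrixP => a b.
rewrite !mxE !mxtens_indexK; congr (S2 _ _ _).
by apply/matrixP => u v; rewrite !mxE.
Qed.

Lemma ge_cbnorm n2 n1 (S : 'M[C]_n2 -> 'M[C]_n1) (r : R) : 0 <= r ->
  cbnorm_le S r -> (cbnorm S <= r%:E)%E.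
Proof.
move=> r0 leS; apply: ge_ereal_sup => _ [k [A [leA ->]]].
apply/(opnorm_leP _ r0); rewrite -[r]mulr1.
by apply: opnorm_le_amplL => //; apply/opnorm_leP.
Qed.

Lemma cbnorm_leP n2 n1 (S : {linear 'M[C]_n2 -> 'M[C]_n1}) (r : R) : 0 <= r ->
  (cbnorm S <= r%:E)%E <-> cbnorm_le S r.
Proof.
move=> r0; split=> [le_S_r|]; last exact: ge_cbnorm.
apply: cbnorm_le_amplL => k A s s0 leA.
have [s_eq0|s_neq0] := eqVneq s 0.
  have A0 : A = 0.
    apply/matrixP => i j; rewrite mxE; move: leA i j; rewrite s_eq0.
    exact: opnorm_le0_eq0.
  rewrite s_eq0 mulr0 A0 linear0; apply: eq_opnorm_le (@opnorm_le0 _ _ _) => i j.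
  by rewrite mxE.
pose B := (s^-1)%:C%C *: A.
have A_B : A = s%:C%C *: B by rewrite scalerA -rmorphM /= divff // scale1r.
have B_le1 : opnorm_le B 1.
  have := opnorm_leZ (s^-1)%:C%C leA.
  rewrite normc_real ger0_norm ?invr_ge0 // mulVf //.
  by apply: eq_opnorm_le => i j; rewrite mxE.
have /(opnorm_leP _ r0) : (opnorm (amplL S B) <= r%:E)%E.
  apply: le_trans le_S_r; apply: ereal_sup_ubound; exists k, B; split=> //.
  exact/opnorm_leP.
move=> /(opnorm_leZ s%:C%C); rewrite normc_real ger0_norm // mulrC.
by apply: eq_opnorm_le => i j; rewrite [in RHS]A_B [in RHS]linearZ [RHS]mxE.
Qed.

Lemma cbnorm_ge0 n2 n1 (S : 'M[C]_n2 -> 'M[C]_n1) : (0 <= cbnorm S)%E.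
Proof.
have vnorm0 n : vnorm (0 : 'cV[C]_n) = 0.
  by rewrite vnormE -[RHS](@l2norm0 _ 'I_n); apply: eq_l2norm => i; rewrite mxE.
apply: (@le_trans _ _ (opnorm (amplL S (0 : 'M[C]_(n2 * 0))))).
  apply: ereal_sup_ubound; exists 0; first by rewrite /= vnorm0.
  by rewrite mulmx0 vnorm0.
apply: ereal_sup_ubound; exists 0, 0; split=> //; apply/opnorm_leP => //.
apply/opnorm_le_mxP => v; rewrite mul0mx vnorm0 mul1r vnormE.
exact: l2norm_ge0.
Qed.

End Norms.

(** * Kraus maps *)

Section Adjoint.
Variable R : rcfType.
Local Notation C := (R[i]).

Definition adj m n (A : 'M[C]_(m, n)) : 'M[C]_(n, m) := (map_mx (@conjc R) A)^T.

Lemma adjE m n (A : 'M[C]_(m, n)) i j : adj A i j = conjc (A j i).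
Proof. by rewrite !mxE. Qed.

Fact adj_is_antilinear m n : linear_for (@conjc R \; *:%R) (@adj m n).
Proof. by move=> c A B; rewrite /adj map_mxD map_mxZ linearP. Qed.

HB.instance Definition _ m n :=
  GRing.isLinear.Build C 'M[C]_(m, n) 'M[C]_(n, m) (@conjc R \; *:%R) (@adj m n)
    (@adj_is_antilinear m n).

Lemma adjK m n : cancel (@adj m n) (@adj n m).
Proof. by move=> A; apply/matrixP => i j; rewrite !adjE conjcK. Qed.

Lemma adjM m n p (A : 'M[C]_(m, n)) (B : 'M[C]_(n, p)) :
  adj (A *m B) = adj B *m adj A.
Proof. by rewrite /adj map_mxM trmx_mul. Qed.

Lemma adj1 n : adj (1%:M : 'M[C]_n) = 1%:M.
Proof. by rewrite /adj map_mx1 trmx1. Qed.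

Lemma adj_delta m n (i : 'I_m) (j : 'I_n) :
  adj (delta_mx i j : 'M[C]_(m, n)) = delta_mx j i.
Proof. by rewrite /adj map_delta_mx trmx_delta. Qed.

Lemma adj_tens m n p q (A : 'M[C]_(m, n)) (B : 'M[C]_(p, q)) :
  adj (A *t B) = adj A *t adj B.
Proof. by rewrite /adj map_mxT trmx_tens. Qed.

End Adjoint.

Section Sandwich.
Variable R : rcfType.
Local Notation C := (R[i]).

Definition sandwich (J : finType) m n p q (K : J -> 'M[C]_(m, n))
    (K' : J -> 'M[C]_(p, q)) (A : 'M[C]_(n, p)) : 'M[C]_(m, q) :=
  \sum_j K j *m A *m K' j.

Section SandwichLinear.
Variables (J : finType) (m n p q : nat).
Variables (K : J -> 'M[C]_(m, n)) (K' : J -> 'M[C]_(p, q)).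

Fact sandwich_is_linear : linear (sandwich K K').
Proof.
move=> c A B; rewrite scaler_sumr -big_split /=; apply: eq_bigr => j _.
by rewrite mulmxDr mulmxDl -scalemxAr -scalemxAl.
Qed.

HB.instance Definition _ :=
  GRing.isLinear.Build C _ _ _ (sandwich K K') sandwich_is_linear.

End SandwichLinear.

Definition kraus (J : finType) n2 n1 (K : J -> 'M[C]_(n1, n2)) :=
  sandwich K (fun j => adj (K j)).

HB.instance Definition _ (J : finType) n2 n1 (K : J -> 'M[C]_(n1, n2)) :=
  GRing.Linear.copy (kraus K) (sandwich K (fun j => adj (K j))).

End Sandwich.

Definition coisometry (R : rcfType) (J : finType) m n (K : J -> 'M[R[i]]_(m, n)) : Prop :=
  \sum_j K j *m adj (K j) = 1%:M.

Definition isometric (R : rcfType) m n (V : 'M[R[i]]_(m, n)) : Prop :=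
  adj V *m V = 1%:M.

Section KrausChannel.
Variable R : realType.
Local Notation C := (R[i]).

Lemma tensmap_sandwich (I J : finType) a2 a1 b2 b1
    (K : I -> 'M[C]_(a1, a2)) (K' : I -> 'M[C]_(a2, a1))
    (L : J -> 'M[C]_(b1, b2)) (L' : J -> 'M[C]_(b2, b1)) :
  tensmap (sandwich K K') (sandwich L L') =1
  sandwich (fun x : I * J => K x.1 *t L x.2) (fun x : I * J => K' x.1 *t L' x.2).
Proof.
apply: eq_linear_tens => A B /=; rewrite tensmap_tens -[LHS]/(tensmxr _ _).
rewrite /sandwich linear_sum.
rewrite -(pair_bigA _ (fun i j => (K i *t L j) *m (A *t B) *m (K' i *t L' j))) /=.
apply: eq_bigr => i _; rewrite /tensmxr linear_sum; apply: eq_bigr => j _.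
by rewrite !tensmx_mul.
Qed.

Lemma amplL_kraus (J : finType) n2 n1 (K : J -> 'M[C]_(n1, n2)) k :
  @amplL R _ _ (kraus K) k =1 kraus (fun j => K j *t 1%:M).
Proof.
apply: eq_linear_tens => A B /=; rewrite amplL_tens -[LHS]/(tensmxr _ _).
rewrite linear_sum; apply: eq_bigr => j _.
by rewrite adj_tens adj1 !tensmx_mul mul1mx mulmx1.
Qed.

Lemma psd_kraus (J : finType) m n (K : J -> 'M[C]_(m, n)) (A : 'M[C]_n) :
  psd A -> psd (kraus K A).
Proof.
move=> psdA v; rewrite mulmx_sumr mulmx_suml summxE; apply: sumr_ge0 => j _.
have := psdA (adj (K j) *m v); rewrite -/(adj _) -/(adj v) adjM adjK.
by rewrite !mulmxA.
Qed.

Lemma sqr_vnorm n (v : 'cV[C]_n) : (vnorm v ^+ 2)%:C%C = (adj v *m v) 0 0.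
Proof.
rewrite vnormE sqr_l2norm mxE rmorph_sum; apply: eq_bigr => i _.
rewrite adjE mulrC -sqr_normc normc_def -rmorphXn /= sqr_normcE sqr_sqrtr //.
by rewrite addr_ge0 ?sqr_ge0.
Qed.

Lemma sum_sqr_vnormD (J : finType) n (v w : J -> 'cV[C]_n) :
  \sum_j adj (v j) *m w j = 0 ->
  \sum_j vnorm (v j + w j) ^+ 2 = \sum_j vnorm (v j) ^+ 2 + \sum_j vnorm (w j) ^+ 2.
Proof.
move=> vw0; have wv0 : \sum_j adj (w j) *m v j = 0.
  have := congr1 (@adj R 1 1) vw0; rewrite linear0 linear_sum; apply: etrans.
  by apply: eq_bigr => j _; rewrite /= adjM adjK.
apply: complexI; rewrite rmorphD !rmorph_sum /=.
under eq_bigr do rewrite sqr_vnorm.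
under [X in _ = X + _]eq_bigr do rewrite sqr_vnorm.
under [X in _ = _ + X]eq_bigr do rewrite sqr_vnorm.
rewrite -!summxE (_ : \sum_j adj (v j + w j) *m _ =
  \sum_j adj (v j) *m v j + \sum_j adj (w j) *m w j); first by rewrite mxE.
under eq_bigr do rewrite [adj (_ + _)]linearD mulmxDl !mulmxDr.
by rewrite !big_split /= vw0 wv0 addr0 add0r.
Qed.

Section Coisometry.
Variables (J : finType) (m n : nat) (K : J -> 'M[C]_(m, n)).
Hypothesis coisometryK : coisometry K.

Lemma sum_sqr_vnorm_adj (v : 'cV[C]_m) :
  \sum_j vnorm (adj (K j) *m v) ^+ 2 = vnorm v ^+ 2.
Proof.
apply: complexI; rewrite rmorph_sum /=.
under eq_bigr do rewrite sqr_vnorm adjM adjK mulmxA -[_ *m K _ *m _]mulmxA.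
by rewrite -summxE -mulmx_suml -mulmx_sumr coisometryK mulmx1 sqr_vnorm.
Qed.

(* Pythagoras, for the orthogonal projection of the family [w] onto the range of
   the isometry with components [adj (K j)]. *)
Lemma vnorm_coisometry_le (w : J -> 'cV[C]_n) :
  vnorm (\sum_j K j *m w j) ^+ 2 <= \sum_j vnorm (w j) ^+ 2.
Proof.
set s := \sum_j _.
pose u j := adj (K j) *m s.
have ortho : \sum_j adj (u j) *m (w j - u j) = 0.
  under eq_bigr do rewrite adjM adjK mulmxBr -!mulmxA [K _ *m u _]mulmxA.
  by rewrite sumrB -!mulmx_sumr -mulmx_suml coisometryK mul1mx subrr.
rewrite [leRHS](eq_bigr (fun j => vnorm (u j + (w j - u j)) ^+ 2)) => [|j _].
  rewrite (sum_sqr_vnormD ortho) sum_sqr_vnorm_adj lerDl.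
  by apply: sumr_ge0 => j _; exact: sqr_ge0.
by rewrite subrKC.
Qed.

Lemma channel_kraus : channel (kraus K).
Proof.
split; first exact: linearP; split.
  by rewrite -coisometryK; apply: eq_bigr => j _; rewrite mulmx1.
by move=> k A psdA; rewrite amplL_kraus; exact: psd_kraus.
Qed.

Lemma opnorm_le_kraus (A : 'M[C]_n) (s : R) :
  0 <= s -> opnorm_le A s -> opnorm_le (kraus K A) s.
Proof.
move=> s0 /opnorm_le_mxP leA; apply/opnorm_le_mxP => v.
rewrite -(ler_pXn2r (isT : (0 < 2)%N)) ?nnegrE ?mulr_ge0 ?sqrtr_ge0 // exprMn.
rewrite -(sum_sqr_vnorm_adj v) mulr_sumr mulmx_suml.
under eq_bigr do rewrite -!mulmxA.
apply: le_trans (vnorm_coisometry_le _) _; apply: ler_sum => j _.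
by rewrite -exprMn ler_pXn2r ?nnegrE ?mulr_ge0 ?sqrtr_ge0.
Qed.

End Coisometry.

Lemma cbnorm_le_kraus (J : finType) n2 n1 (K : J -> 'M[C]_(n1, n2)) :
  coisometry K -> cbnorm_le (kraus K) 1.
Proof.
move=> K1; apply: cbnorm_le_amplL => k A s s0 leA; rewrite mul1r amplL_kraus.
apply: opnorm_le_kraus => //.
rewrite /coisometry -tensmx11 -K1 -[RHS]/(tensmxr _ _) linear_sum.
by apply: eq_bigr => j _; rewrite adj_tens adj1 tensmx_mul mulmx1.
Qed.

End KrausChannel.

(** * Expansion of tensor powers *)

Section Sandwiched.
Variable R : rcfType.
Local Notation C := (R[i]).

Definition sandwiched n (P : 'M[C]_n -> Prop) (Phi : 'M[C]_n -> 'M[C]_n) : Prop :=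
  exists (J : finType) (K K' : J -> 'M[C]_n),
    [/\ forall j, P (K j), forall j, P (K' j) &
        Phi =1 sandwich (fun j => adj (K j)) K'].

Section Theory.
Variables (n : nat) (P : 'M[C]_n -> Prop).
Implicit Types Phi Psi : 'M[C]_n -> 'M[C]_n.

Lemma eq_sandwiched Phi Psi : Phi =1 Psi -> sandwiched P Phi -> sandwiched P Psi.
Proof.
move=> PhiPsi [J [K [K' [PK PK' PhiE]]]]; exists J, K, K'; split=> // A.
by rewrite -PhiPsi.
Qed.

Lemma sandwiched0 : sandwiched P (fun=> 0).
Proof.
exists void, (fun=> 0), (fun=> 0); split=> [[]|[]|A].
by rewrite /sandwich big1 // => -[].
Qed.

Lemma sandwichedD Phi Psi :
  sandwiched P Phi -> sandwiched P Psi -> sandwiched P (Phi \+ Psi).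
Proof.
move=> [I [K [K' [PK PK' PhiE]]]] [J [L [L' [PL PL' PsiE]]]].
exists (I + J)%type, (fun x => match x with inl i => K i | inr j => L j end).
exists (fun x => match x with inl i => K' i | inr j => L' j end).
by split=> [[]|[]|A] //; rewrite /= PhiE PsiE /sandwich big_sumType.
Qed.

Lemma sandwiched_id : P 1%:M -> sandwiched P idfun.
Proof.
move=> P1; exists unit, (fun=> 1%:M), (fun=> 1%:M); split=> // A.
by rewrite /sandwich (big_pred1 tt) => [|[]//]; rewrite adj1 mul1mx mulmx1.
Qed.

End Theory.

Lemma sandwiched_linear n (L : {linear 'M[C]_n -> 'M[C]_n}) :
  sandwiched (fun=> True) L.
Proof.
exists (('I_n * 'I_n) * ('I_n * 'I_n))%type, (fun q => delta_mx q.1.1 q.2.1).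
exists (fun q => L (delta_mx q.1.1 q.1.2) q.2.1 q.2.2 *: delta_mx q.1.2 q.2.2).
split=> // A; rewrite /sandwich.
under eq_bigr do rewrite adj_delta -scalemxAr mul_delta_mx_delta scalerA mulrC -scalerA.
rewrite -(pair_bigA _ (fun p q => A p.1 p.2 *:
  (L (delta_mx p.1 p.2) q.1 q.2 *: delta_mx q.1 q.2))) /=.
rewrite -(pair_bigA _ (fun i j => \sum_q A i j *:
  (L (delta_mx i j) q.1 q.2 *: delta_mx q.1 q.2))) /=.
rewrite [in LHS](matrix_sum_delta A) linear_sum; apply: eq_bigr => i _.
rewrite linear_sum; apply: eq_bigr => j _; rewrite linearZ -scaler_sumr.
congr (_ *: _); rewrite [LHS]matrix_sum_delta.
exact: (pair_bigA _ (fun k l => L (delta_mx i j) k l *: delta_mx k l)).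
Qed.

End Sandwiched.

Lemma sandwiched_tensmap (R : realType) m n (P : 'M[R[i]]_m -> Prop)
    (Q : 'M[R[i]]_n -> Prop) (PQ : 'M[R[i]]_(m * n) -> Prop) Phi Psi :
    (forall A B, P A -> Q B -> PQ (A *t B)) ->
  sandwiched P Phi -> sandwiched Q Psi -> sandwiched PQ (tensmap Phi Psi).
Proof.
move=> tensPQ [I [K [K' [PK PK' PhiE]]]] [J [L [L' [QL QL' PsiE]]]].
exists (I * J)%type, (fun x => K x.1 *t L x.2), (fun x => K' x.1 *t L' x.2).
split=> [x|x|A]; [exact: tensPQ|exact: tensPQ|].
rewrite (eq_tensmap PhiE PsiE) tensmap_sandwich.
by apply: eq_bigr => x _; rewrite adj_tens.
Qed.

Section TensorPower.
Variables (R : realType) (d : nat).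
Local Notation C := (R[i]).
Variable L : {linear 'M[C]_d -> 'M[C]_d}.

(* The coefficient of [t ^ j] in the [n]-th tensor power of [id + t L]. *)
Fixpoint tpow_coef n : nat -> {linear 'M[C]_(pw d n) -> 'M[C]_(pw d n)} :=
  match n as n0 return nat -> {linear 'M[C]_(pw d n0) -> 'M[C]_(pw d n0)} with
  | 0 => fun j => if j is 0 then idfun else \0
  | n'.+1 => fun j =>
      if j is j'.+1 then tensmap idfun (tpow_coef n' j) \+ tensmap L (tpow_coef n' j')
      else tensmap idfun (tpow_coef n' 0)
  end.

Lemma tpow_coefS n j A : tpow_coef n.+1 j A =
  tensmap idfun (tpow_coef n j) A +
  (if j is j'.+1 then tensmap L (tpow_coef n j') A else 0).
Proof. by case: j => //=; rewrite addr0. Qed.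

Lemma tpow_coef0 n : tpow_coef n 0 =1 id.
Proof.
elim: n => // n IHn A; rewrite tpow_coefS addr0 -[RHS]tensmap_id.
exact: eq_tensmap.
Qed.

Lemma tpow_coef_gt n j A : (n < j)%N -> tpow_coef n j A = 0.
Proof.
elim: n j A => [|n IHn] [|j] A // lt_nj; rewrite tpow_coefS.
by rewrite !tensmap0r ?addr0 // => X; rewrite IHn // ltnW.
Qed.

Lemma tpow_coef_unital n j : L 1%:M = 0 -> (0 < j)%N -> tpow_coef n j 1%:M = 0.
Proof.
move=> L1; elim: n j => [|n IHn] [|j] // _; rewrite tpow_coefS -tensmx11.
by rewrite !tensmap_tens L1 IHn // linear0 tens0mx addr0.
Qed.

Lemma tpow_expansion (T : 'M[C]_d -> 'M[C]_d) n A : T =1 idfun \+ L ->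
  tpow T (n := n) A = \sum_(j < n.+1) tpow_coef n j A.
Proof.
move=> TE; elim: n A => [|n IHn] A; first by rewrite big_ord1.
rewrite [LHS](eq_tensmap TE IHn) tensmapDl !tensmap_sumr.
under [RHS]eq_bigr do rewrite tpow_coefS.
rewrite [RHS]big_split; congr (_ + _).
  rewrite [RHS]big_ord_recr -[LHS]addr0; congr (_ + _).
  by rewrite tensmap0r // => X; exact: tpow_coef_gt.
by rewrite [RHS]big_ord_recl /= add0r; apply: eq_bigr.
Qed.

Lemma cbnorm_le_tpow_coef n j (delta : R) : 0 <= delta -> cbnorm_le L delta ->
  cbnorm_le (tpow_coef n j) ('C(n, j)%:R * delta ^+ j).
Proof.
move=> delta0 leL; elim: n j => [|n IHn] j.
  case: j => [|j]; first by rewrite bin0 mulr1; exact: cbnorm_le_id.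
  by rewrite bin0n mul0r; exact: cbnorm_le0.
have coef_ge0 i : 0 <= 'C(n, i)%:R * delta ^+ i by rewrite mulr_ge0 // exprn_ge0.
have := cbnorm_le_tensmap (coef_ge0 j) (@cbnorm_le_id R d) (IHn j).
rewrite mul1r; case: j => [|j] le_id.
  by rewrite bin0 -(bin0 n); apply: eq_cbnorm_le le_id => A; rewrite tpow_coefS addr0.
have le_L := cbnorm_le_tensmap (coef_ge0 j) leL (IHn j).
have -> : 'C(n.+1, j.+1)%:R * delta ^+ j.+1 =
    'C(n, j.+1)%:R * delta ^+ j.+1 + delta * ('C(n, j)%:R * delta ^+ j).
  by rewrite binS natrD exprS; ring.
exact: cbnorm_leD.
Qed.

Inductive local_op : forall n, nat -> 'M[C]_(pw d n) -> Prop :=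
| local_op0 j : @local_op 0 j 1%:M
| local_op_tens1 n j (K : 'M[C]_(pw d n)) :
    local_op j K -> @local_op n.+1 j ((1%:M : 'M[C]_d) *t K)
| local_op_tens n j (A : 'M[C]_d) (K : 'M[C]_(pw d n)) :
    local_op j K -> @local_op n.+1 j.+1 (A *t K).

Lemma sandwiched_tpow_coef n j : sandwiched (@local_op n j) (tpow_coef n j).
Proof.
elim: n j => [|n IHn] j.
  case: j => [|j]; last exact: sandwiched0.
  by apply: sandwiched_id; exact: local_op0.
have sandwiched_tens1 : sandwiched (@local_op n.+1 j) (tensmap idfun (tpow_coef n j)).
  apply: (@sandwiched_tensmap _ _ _ (fun A => A = 1%:M)) (IHn j).
    by move=> _ K -> loc_K; exact: local_op_tens1.
  exact: sandwiched_id.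
case: j sandwiched_tens1 => [|j] sandwiched_tens1.
  by apply: eq_sandwiched sandwiched_tens1 => A; rewrite tpow_coefS addr0.
apply: sandwichedD sandwiched_tens1 _.
apply: sandwiched_tensmap (sandwiched_linear L) (IHn j) => A K _ loc_K.
exact: local_op_tens.
Qed.

End TensorPower.

(** * Error correction *)

Lemma memv_sum_lines (K : fieldType) (vT : vectType K) (I : finType) (P : pred I)
    (f : I -> vT) i :
  P i -> f i \in (\sum_(i | P i) <[f i]>)%VS.
Proof. by move=> Pi; apply: subvP (memv_line (f i)); exact: sumv_sup (subvv _). Qed.

Lemma sum_lines_coords (K : fieldType) (vT : vectType K) (I : finType) (P : pred I)
    (f : I -> vT) v :
  v \in (\sum_(i | P i) <[f i]>)%VS -> exists c : I -> K, v = \sum_(i | P i) c i *: f i.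
Proof.
case/memv_sumP=> u in_line ->.
have /choice[c cE] i : exists c, P i -> u i = c *: f i.
  by have [/in_line/vlineP[c ->]|_] := boolP (P i); [exists c | exists 0].
by exists c; apply: eq_bigr => i Pi; rewrite cE.
Qed.

Lemma tensmx_sum_lines (K : fieldType) m1 n1 m2 n2 (I J : finType)
    (P : pred I) (Q : pred J) (A : I -> 'M[K]_(m1, n1)) (B : J -> 'M[K]_(m2, n2))
    (U : {vspace 'M[K]_(m1 * m2, n1 * n2)}) X Y :
    (forall i j, P i -> Q j -> A i *t B j \in U) ->
    X \in (\sum_(i | P i) <[A i]>)%VS -> Y \in (\sum_(j | Q j) <[B j]>)%VS ->
  X *t Y \in U.
Proof.
move=> AB_U /sum_lines_coords[x ->] /sum_lines_coords[y ->]; rewrite linear_sum.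
apply: memv_suml => j Qj; rewrite linearZ memvZ // -[X in X \in _]/(tensmxr _ _).
rewrite linear_sum; apply: memv_suml => i Pi; rewrite linearZ memvZ //.
exact: AB_U.
Qed.

Section Recovery.
Variables (R : rcfType) (N m : nat) (J : finType) (W : J -> 'M[R[i]]_(N, m.+1)).
Local Notation C := (R[i]).

Definition orthogonal_isometries : Prop :=
  forall p q, adj (W p) *m W q = (p == q)%:R%:M.

Definition defect : 'M[C]_N := 1%:M - \sum_p W p *m adj (W p).

(* The Heisenberg picture of the recovery that undoes [W p] on its range, and that
   prepares a fixed basis state on the orthogonal complement of all the ranges. *)
Definition recovery_kraus (x : J + 'I_N) : 'M[C]_(N, m.+1) :=
  match x with inl p => W p | inr l => defect *m delta_mx l 0 end.

Definition recovery : 'M[C]_m.+1 -> 'M[C]_N := kraus recovery_kraus.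

HB.instance Definition _ := GRing.Linear.copy recovery (kraus recovery_kraus).

Hypothesis orthoW : orthogonal_isometries.

Lemma defect_mul p : defect *m W p = 0.
Proof.
rewrite mulmxBl mul1mx mulmx_suml (bigD1 p) //= big1 => [|q /negbTE qp].
  by rewrite -mulmxA orthoW eqxx mulmx1 addr0 subrr.
by rewrite -mulmxA orthoW qp raddf0 mulmx0.
Qed.

Lemma adj_defect : adj defect = defect.
Proof.
rewrite linearB linear_sum /= adj1; congr (_ - _); apply: eq_bigr => p _.
by rewrite adjM adjK.
Qed.

Lemma defect_idem : defect *m defect = defect.
Proof.
rewrite {2}/defect mulmxBr mulmx1 mulmx_sumr big1 ?subr0 // => p _.
by rewrite mulmxA defect_mul mul0mx.
Qed.

Lemma recoveryE X :
  recovery X = \sum_p W p *m X *m adj (W p) + X 0 0 *: defect.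
Proof.
rewrite /recovery /kraus /sandwich big_sumType; congr (_ + _).
transitivity (defect *m (\sum_l X 0 0 *: delta_mx l l) *m defect).
  rewrite mulmx_sumr mulmx_suml; apply: eq_bigr => l _.
  by rewrite -mul_delta_mx_delta /= adjM adj_delta adj_defect !mulmxA.
by rewrite -scaler_sumr -mx1_sum_delta -scalemxAr -scalemxAl mulmx1 defect_idem.
Qed.

Lemma coisometry_recovery : coisometry recovery_kraus.
Proof.
have := recoveryE 1%:M; rewrite /coisometry /recovery /kraus /sandwich.
under eq_bigr do rewrite mulmx1.
move=> ->; under eq_bigr do rewrite mulmx1.
by rewrite mxE eqxx scale1r addrC subrK.
Qed.

Lemma recovery_pair p q X :
  adj (W p) *m recovery X *m W q = (p == q)%:R *: X.
Proof.
rewrite recoveryE mulmxDr mulmxDl -scalemxAr -scalemxAl -[_ *m defect *m _]mulmxA.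
rewrite defect_mul mulmx0 scaler0 addr0 mulmx_sumr mulmx_suml.
rewrite (bigD1 p) //= big1 => [|r /negbTE rp].
  by rewrite !mulmxA orthoW eqxx mul1mx -mulmxA orthoW mul_mx_scalar addr0.
by rewrite !mulmxA orthoW eq_sym rp raddf0 !mul0mx.
Qed.

Lemma recovery_span A B :
    A \in (\sum_p <[W p]>)%VS -> B \in (\sum_p <[W p]>)%VS ->
  exists c, forall X, adj A *m recovery X *m B = c *: X.
Proof.
move=> /sum_lines_coords[a ->] /sum_lines_coords[b ->].
exists (\sum_p conjc (a p) * b p) => X.
rewrite [adj _]linear_sum !mulmx_suml scaler_suml; apply: eq_bigr => p _.
rewrite /= linearZ /= -!scalemxAl mulmx_sumr -scalerA; congr (_ *: _).
rewrite (bigD1 p) //= big1 => [|q /negbTE qp].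
  by rewrite -scalemxAr recovery_pair eqxx scale1r addr0.
by rewrite -scalemxAr recovery_pair eq_sym qp scale0r scaler0.
Qed.

Section Encoder.
Variable V : 'M[C]_(N, m.+1).
Hypothesis isometricV : isometric V.

Definition encoder_kraus (_ : unit) : 'M[C]_(m.+1, N) := adj V.

Definition encoder : 'M[C]_N -> 'M[C]_m.+1 := kraus encoder_kraus.

HB.instance Definition _ := GRing.Linear.copy encoder (kraus encoder_kraus).

Lemma encoderE A : encoder A = adj V *m A *m V.
Proof. by rewrite /encoder /kraus /sandwich (big_pred1 tt) => [|[]//]; rewrite adjK. Qed.

Lemma coisometry_encoder : coisometry encoder_kraus.
Proof. by rewrite /coisometry (big_pred1 tt) => [|[]//]; rewrite adjK. Qed.

(* A correctable error acts as a scalar on the encoded system, and evaluating it at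
   the identity determines this scalar. *)
Lemma encoder_recovery (P : 'M[C]_N -> Prop) Phi c :
    (forall K, P K -> K *m V \in (\sum_p <[W p]>)%VS) ->
    sandwiched P Phi -> Phi 1%:M = c%:M ->
  forall X, encoder (Phi (recovery X)) = c *: X.
Proof.
move=> P_span [I [K [K' [PK PK' PhiE]]]] Phi1 X.
have /choice[a aE] i : exists a, forall Y,
    adj V *m (adj (K i) *m recovery Y *m K' i) *m V = a *: Y.
  have [a aE] := recovery_span (P_span _ (PK i)) (P_span _ (PK' i)).
  by exists a => Y; rewrite -aE adjM !mulmxA.
have scalar Y : encoder (Phi (recovery Y)) = (\sum_i a i) *: Y.
  rewrite PhiE encoderE mulmx_sumr mulmx_suml scaler_suml.
  by apply: eq_bigr => i _; rewrite aE.
have recovery1 : recovery 1%:M = 1%:M.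
  by rewrite -[RHS]coisometry_recovery; apply: eq_bigr => x _; rewrite mulmx1.
rewrite scalar; congr (_ *: _); have := scalar 1%:M.
rewrite recovery1 Phi1 encoderE mul_mx_scalar -scalemxAl isometricV.
by move=> /matrixP/(_ 0 0); rewrite !mxE !mulr1.
Qed.

End Encoder.
End Recovery.

Section DeltaBounds.
Variable R : realType.
Local Notation C := (R[i]).

Lemma Delta_ge0 n2 n1 (T : 'M[C]_n2 -> 'M[C]_n1) m : (0 <= Delta T m)%E.
Proof. by apply: le_ereal_inf_tmp => _ [E _ [D _ <-]]; exact: cbnorm_ge0. Qed.

Lemma Delta_le n2 n1 (T : 'M[C]_n2 -> 'M[C]_n1) m (E : 'M[C]_n1 -> 'M[C]_m)
    (D : 'M[C]_m -> 'M[C]_n2) (r : R) :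
    channel E -> channel D -> 0 <= r ->
  cbnorm_le (fun X => E (T (D X)) - X) r -> (Delta T m <= r%:E)%E.
Proof.
move=> channelE channelD r0 le_r; apply: le_trans (ge_cbnorm r0 le_r).
by apply: ereal_inf_lbound; exists E => //; exists D.
Qed.

Lemma Delta_dim1 n2 n1 (T : 'M[C]_n2 -> 'M[C]_n1) :
  (0 < n1)%N -> (forall c, T c%:M = c%:M) -> Delta T 1 = 0%E.
Proof.
move=> n1_gt0 T_scalar; apply/le_anti; rewrite Delta_ge0 andbT.
pose W (p : void) : 'M[C]_(n2, 1) := 0.
have orthoW : orthogonal_isometries W by case.
pose V : 'M[C]_(n1, 1) := delta_mx (Ordinal n1_gt0) 0.
have isometricV : isometric V.
  by rewrite /isometric adj_delta mul_delta_mx [LHS]mx11_scalar mxE.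
apply: (@Delta_le _ _ _ _ (encoder V) (recovery W)) => //.
- exact/channel_kraus/coisometry_encoder.
- exact/channel_kraus/coisometry_recovery.
apply: eq_cbnorm_le (@cbnorm_le0 _ _ _) => X; apply/esym/eqP; rewrite subr_eq0.
have -> : recovery W X = (X 0 0)%:M.
  by rewrite recoveryE // /defect !big1 ?add0r ?subr0 ?scalemx1 // => -[].
rewrite T_scalar encoderE mul_mx_scalar -scalemxAl isometricV scalemx1.
by rewrite -mx11_scalar.
Qed.

Definition binomial_tail n f (delta : R) : R :=
  \sum_(j < n.+1 | (f < j)%N) 'C(n, j)%:R * delta ^+ j.

Section TensorPowerDelta.
Variables (d : nat) (T : 'M[C]_d -> 'M[C]_d) (L : {linear 'M[C]_d -> 'M[C]_d}).
Hypothesis T_decomp : T =1 idfun \+ L.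
Hypothesis L1 : L 1%:M = 0.

Lemma tpow_scalar n c : tpow T (n := n) c%:M = c%:M.
Proof.
rewrite (tpow_expansion _ T_decomp) big_ord_recl tpow_coef0 big1 ?addr0 // => j _.
by rewrite -scalemx1 linearZ /= tpow_coef_unital // scaler0.
Qed.

Variable delta : R.
Hypothesis delta_ge0 : 0 <= delta.
Hypothesis leL : cbnorm_le L delta.

Lemma Delta_tpow_le n m f (E : {linear 'M[C]_(pw d n) -> 'M[C]_m})
    (D : 'M[C]_m -> 'M[C]_(pw d n)) :
    channel E -> channel D -> cbnorm_le E 1 -> cbnorm_le D 1 ->
    (forall j X, (j <= f)%N -> E (tpow_coef L n j (D X)) = (j == 0)%:R *: X) ->
  (Delta (tpow T (n := n)) m <= (binomial_tail n f delta)%:E)%E.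
Proof.
move=> channelE channelD leE leD corrects.
have coef_ge0 j : 0 <= 'C(n, j)%:R * delta ^+ j by rewrite mulr_ge0 // exprn_ge0.
apply: Delta_le channelE channelD (sumr_ge0 _ _) _ => //.
apply: (@eq_cbnorm_le _ _ _
    (fun X => \sum_(j < n.+1 | (f < j)%N) E (tpow_coef L n j (D X)))) => [X|].
  rewrite (tpow_expansion _ T_decomp) linear_sum.
  rewrite [in RHS](bigID (fun j : 'I_n.+1 => (f < j)%N)) /=.
  rewrite -addrA -[LHS]addr0; congr (_ + _).
  rewrite (bigD1 ord0) //= corrects // scale1r big1 ?addr0 ?subrr // => j.
  by rewrite -leqNgt -lt0n => /andP[le_jf /gtn_eqF j0]; rewrite corrects // j0 scale0r.
apply: cbnorm_le_sum => j _.
have := cbnorm_le_comp ler01 (@cbnorm_le_tpow_coef _ _ L n j _ delta_ge0 leL) leD.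
by rewrite mulr1 => /(cbnorm_le_comp (coef_ge0 j) leE); rewrite mul1r.
Qed.

Lemma Delta_tpow_code n m f (J : finType) (W : J -> 'M[C]_(pw d n, m.+1))
    (V : 'M[C]_(pw d n, m.+1)) :
    orthogonal_isometries W -> isometric V ->
    (forall j (K : 'M[C]_(pw d n)), (j <= f)%N -> local_op j K ->
      K *m V \in (\sum_p <[W p]>)%VS) ->
  (Delta (tpow T (n := n)) m.+1 <= (binomial_tail n f delta)%:E)%E.
Proof.
move=> orthoW isometricV spanW.
have coE := coisometry_encoder isometricV; have coD := coisometry_recovery orthoW.
apply: (Delta_tpow_le (channel_kraus coE) (channel_kraus coD)
  (cbnorm_le_kraus coE) (cbnorm_le_kraus coD)) => j X le_jf.
apply: (encoder_recovery orthoW isometricV) (sandwiched_tpow_coef L n j) _ _.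
  by move=> K; exact: spanW.
case: j le_jf => [|j] _; first by rewrite tpow_coef0.
by rewrite tpow_coef_unital // raddf0.
Qed.

End TensorPowerDelta.
End DeltaBounds.

(** * Graph codes *)

Section Dot.
Variable F : comNzRingType.

Definition dot n (a b : 'rV[F]_n) : F := (a *m b^T) 0 0.

Section Theory.
Variable n : nat.
Implicit Types a b : 'rV[F]_n.

Lemma dotC a b : dot a b = dot b a.
Proof. by rewrite /dot -[RHS]trace_mx11 -mxtrace_tr trmx_mul trmxK trace_mx11. Qed.

Lemma dotDl a a' b : dot (a + a') b = dot a b + dot a' b.
Proof. by rewrite /dot mulmxDl mxE. Qed.

Lemma dotDr a b b' : dot a (b + b') = dot a b + dot a b'.
Proof. by rewrite dotC dotDl ![dot _ a]dotC. Qed.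

Lemma dotNl a b : dot (- a) b = - dot a b.
Proof. by rewrite /dot mulNmx mxE. Qed.

Lemma dot0l b : dot 0 b = 0.
Proof. by rewrite /dot mul0mx mxE. Qed.

Lemma dot_delta a i c : dot a (c *: delta_mx 0 i) = c * a 0 i.
Proof. by rewrite /dot linearZ /= trmx_delta -scalemxAr mxE -colE mxE. Qed.

End Theory.

Lemma dot_row n m (a b : 'rV[F]_n) (a' b' : 'rV[F]_m) :
  dot (row_mx a a') (row_mx b b') = dot a b + dot a' b'.
Proof. by rewrite /dot tr_row_mx mul_row_col mxE. Qed.

End Dot.

Section RowCons.
Variable F : comNzRingType.

Definition rVcons n (x : F) (a : 'rV[F]_n) : 'rV[F]_n.+1 := row_mx (x%:M : 'rV_1) a.

Lemma eq_rVcons n (x y : F) (a b : 'rV[F]_n) :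
  (rVcons x a == rVcons y b) = (x == y) && (a == b).
Proof.
apply/eqP/andP=> [/(@eq_row_mx F 1 1 n)[/matrixP/(_ 0 0)]|[/eqP-> /eqP->]//].
by rewrite !mxE !mulr1n => -> ->; rewrite !eqxx.
Qed.

Lemma rVconsD n (x y : F) (a b : 'rV[F]_n) :
  rVcons x a + rVcons y b = rVcons (x + y) (a + b).
Proof. by rewrite /rVcons (@add_row_mx _ 1 1 n) -raddfD. Qed.

Lemma dot_rVcons n (x y : F) (a b : 'rV[F]_n) :
  dot (rVcons x a) (rVcons y b) = x * y + dot a b.
Proof.
rewrite /rVcons (@dot_row _ 1 n); congr (_ + _).
by rewrite /dot tr_scalar_mx -scalar_mxM mxE.
Qed.

End RowCons.

Section Weight.
Variable F : nzRingType.

(* The number of sites on which the Pauli operator with shift [a] and phase [b]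
   acts nontrivially. *)
Definition wt n (a b : 'rV[F]_n) : nat :=
  \sum_i ((a 0%R i != 0%R) || (b 0%R i != 0%R)).

Lemma wt0 n : wt 0 (0 : 'rV[F]_n) = 0%N.
Proof. by rewrite /wt big1 // => i _; rewrite mxE eqxx. Qed.

Lemma wtB n (a b a' b' : 'rV[F]_n) : (wt (a' - a) (b' - b) <= wt a b + wt a' b')%N.
Proof.
rewrite /wt -big_split /=; apply: leq_sum => i _; rewrite !mxE.
case: (eqVneq (a 0 i) 0) => [->|_] /=; last by rewrite (leq_trans (leq_b1 _)).
case: (eqVneq (b 0 i) 0) => [->|_] /=; last by rewrite (leq_trans (leq_b1 _)).
by rewrite !subr0.
Qed.

End Weight.

Lemma wt_rVcons (F : comNzRingType) n (x y : F) (a b : 'rV[F]_n) :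
  wt (rVcons x a) (rVcons y b) = (((x != 0%R) || (y != 0%R)) + wt a b)%N.
Proof.
rewrite /wt /rVcons (@big_split_ord _ _ _ 1 n) /= big_ord1.
rewrite !(@row_mxEl _ 1 1 n) !mxE !mulr1n; congr (_ + _)%N.
by apply: eq_bigr => i _; rewrite !(@row_mxEr _ 1 1 n).
Qed.

Definition wt_ball (F : finNzRingType) n w : {set 'rV[F]_n * 'rV[F]_n} :=
  [set p | (wt p.1 p.2 <= w)%N].

Lemma sum_nontrivial_char (K : idomainType) (G : finZmodType) (psi : G -> K) :
    {morph psi : x y / x + y >-> x * y} -> (exists x, psi x != 1) ->
  \sum_x psi x = 0.
Proof.
move=> psiD [x psi_x]; set s := \sum_y _; have /eqP : s = psi x * s.
  rewrite {1}/s (reindex_inj (addrI x)) mulr_sumr.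
  by apply: eq_bigr => y _; rewrite psiD.
rewrite -subr_eq0 -{1}[s]mul1r -mulrBl mulf_eq0 subr_eq0 eq_sym.
by rewrite (negbTE psi_x) => /eqP.
Qed.

Record add_char (R : rcfType) (F : finFieldType) := AddChar {
  add_char_fun :> F -> R[i];
  add_char0 : add_char_fun 0 = 1;
  add_charD : {morph add_char_fun : x y / x + y >-> x * y};
  add_charN : forall x, add_char_fun (- x) = conjc (add_char_fun x);
  add_char_nontrivial : exists x, add_char_fun x != 1
}.

Section CharacterSums.
Variables (R : rcfType) (F : finFieldType) (chi : add_char R F).

Lemma sum_char_mul (x : F) : \sum_y chi (x * y) = ((x == 0) * #|F|)%:R.
Proof.
have [->|x_neq0] := eqVneq x 0.
  under eq_bigr do rewrite mul0r add_char0.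
  by rewrite sumr_const mul1n.
apply: sum_nontrivial_char => [y z|]; first by rewrite mulrDr add_charD.
by have [z chi_z] := add_char_nontrivial chi; exists (z / x); rewrite mulrC divfK.
Qed.

Lemma sum_char_dot n (v : 'rV[F]_n) :
  \sum_y chi (dot v y) = ((v == 0) * #|F| ^ n)%:R.
Proof.
have [->|/rV0Pn[i v_i]] := eqVneq v 0.
  under eq_bigr do rewrite dot0l add_char0.
  by rewrite sumr_const card_mx !mul1n.
apply: sum_nontrivial_char => [y z|]; first by rewrite dotDr add_charD.
have [z chi_z] := add_char_nontrivial chi; exists ((z / v 0 i) *: delta_mx 0 i).
by rewrite dot_delta divfK.
Qed.

End CharacterSums.

Lemma add_char_Fp (R : rcfType) (p : nat) : prime p -> add_char R 'F_p.
Proof.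
move=> p_prime; have p_gt1 := prime_gt1 p_prime; have p_gt0 := ltnW p_gt1.
have [om sum_om] : {om : R[i] | \sum_(i < p) om ^+ i = 0}.
  have /closed_rootP/sigW[om /rootP] : size (\poly_(i < p) (1 : R[i])) != 1%N.
    by rewrite size_poly_eq ?oner_eq0 // gtn_eqF.
  rewrite horner_poly => sum_om; exists om.
  by rewrite -[RHS]sum_om; apply: eq_bigr => i _; rewrite mul1r.
have om_p : om ^+ p = 1 by apply/eqP; rewrite -subr_eq0 subrX1 sum_om mulr0.
have om_neq1 : om != 1.
  apply: contra_eq_neq sum_om => ->; under eq_bigr do rewrite expr1n.
  by rewrite sumr_const card_ord pnatr_eq0 -lt0n.
have om_mod r : om ^+ (r %% (Zp_trunc (pdiv p)).+2) = om ^+ r.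
  by rewrite Fp_cast // expr_mod.
have om_D (x y : 'F_p) : om ^+ (x + y)%R = om ^+ x * om ^+ y.
  by rewrite om_mod exprD.
have om_unitary (x : 'F_p) : om ^+ x * conjc (om ^+ x) = 1.
  rewrite -sqr_normc normrX -exprM mulnC exprM.
  have /eqP -> : `|om| == 1 by rewrite -(@pexpr_eq1 _ _ p) // -normrX om_p normr1.
  by rewrite !expr1n.
exists (fun x : 'F_p => om ^+ x) => //.
- move=> x; have om_x_neq0 : om ^+ x != 0.
    by apply: contra_eq_neq (om_unitary x) => ->; rewrite mul0r eq_sym oner_eq0.
  by apply: (mulfI om_x_neq0); rewrite om_unitary -om_D subrr.
- by exists 1; rewrite om_mod expr1.
Qed.

Section QuadraticForm.
Variables (F : comNzRingType) (k n : nat) (G : 'M[F]_(k + n)).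

Definition qform (z : 'rV[F]_(k + n)) : F := dot (z *m G) z.

Lemma qformD z u : qform (z + u) = qform z + qform u + dot (u *m (G + G^T)) z.
Proof.
have dot_tr : dot (z *m G) u = dot (u *m G^T) z.
  by rewrite dotC /dot trmx_mul mulmxA -[RHS]trace_mx11 -[LHS]trace_mx11 -mulmxA.
by rewrite /qform mulmxDl !dotDl !dotDr mulmxDr dotDl dot_tr; ring.
Qed.

(* The phase picked up by the Pauli operator with shift [a] that connects the code
   words [x] and [x'] is the output part of [(x' - x, a) (G + G^T)]. *)
Definition connecting_phase (u : 'rV[F]_(k + n)) : 'rV[F]_n :=
  rsubmx (u *m (G + G^T)).

Definition good_graph w : Prop := forall x (a b : 'rV[F]_n),
  (wt a b <= w)%N -> b = connecting_phase (row_mx x a) ->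
  row_mx x a = 0 :> 'rV_(k + n).

End QuadraticForm.

Section Pauli.
Variables (R : realType) (F : finFieldType) (chi : add_char R F).
Local Notation C := (R[i]).
Variables (d : nat) (e : 'I_d -> F).
Hypothesis e_bij : bijective e.

Fixpoint label n : 'I_(pw d n) -> 'rV[F]_n :=
  match n as n0 return 'I_(pw d n0) -> 'rV[F]_n0 with
  | 0 => fun=> 0
  | n'.+1 => fun i => rVcons (e (mxtens_unindex i).1) (label (mxtens_unindex i).2)
  end.

Lemma label_mxtens n (i1 : 'I_d) (i2 : 'I_(pw d n)) :
  @label n.+1 (mxtens_index (i1, i2)) = rVcons (e i1) (label i2).
Proof. by rewrite /label -/label mxtens_indexK. Qed.

Lemma card_alphabet : #|F| = d.
Proof. by rewrite -(bij_eq_card e_bij) card_ord. Qed.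

Lemma label_bij n : bijective (@label n).
Proof.
apply: inj_card_bij; last first.
  rewrite card_mx card_ord mul1n card_alphabet.
  by elim: n => //= n IHn; rewrite expnS leq_mul2l IHn orbT.
elim: n => [i j _|n IHn i j]; first by rewrite !ord1.
case: (mxtens_indexP i) => i1 i2; case: (mxtens_indexP j) => j1 j2.
move/eqP; rewrite !label_mxtens eq_rVcons (bij_eq e_bij).
by move=> /andP[/eqP-> /eqP/IHn->].
Qed.

Lemma sum_label n (g : 'rV[F]_n -> C) : \sum_i g (label i) = \sum_y g y.
Proof. by rewrite [RHS](reindex (@label n)) //; exact/onW_bij/label_bij. Qed.

Lemma sum_label_eq n (g : 'rV[F]_n -> C) v :
  \sum_(i : 'I_(pw d n)) (if label i == v then g (label i) else 0) = g v.
Proof.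
rewrite (sum_label (fun y => if y == v then g y else 0)) -big_mkcond.
exact: big_pred1_eq.
Qed.

Definition pauli n (a b : 'rV[F]_n) : 'M[C]_(pw d n) :=
  \matrix_(i, j) if label i == label j + a then chi (dot b (label j)) else 0.

Definition site_pauli (x y : F) : 'M[C]_d :=
  \matrix_(i, j) if e i == e j + x then chi (y * e j) else 0.

Lemma pauli00 n : pauli 0 (0 : 'rV[F]_n) = 1%:M.
Proof.
apply/matrixP => i j; rewrite !mxE addr0 dot0l add_char0 (bij_eq (label_bij n)).
by case: eqP.
Qed.

Lemma site_pauli00 : site_pauli 0 0 = 1%:M.
Proof.
apply/matrixP => i j; rewrite !mxE addr0 mul0r add_char0 (bij_eq e_bij).
by case: eqP.
Qed.

Lemma pauli_tens n x y (a b : 'rV[F]_n) :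
  site_pauli x y *t pauli a b = pauli (rVcons x a) (rVcons y b).
Proof.
apply: eq_mxtens => i1 i2 j1 j2; rewrite tensmxE !mxE !label_mxtens.
rewrite rVconsD eq_rVcons dot_rVcons add_charD.
by case: eqP => _; case: eqP => _; rewrite /= ?mul0r ?mulr0.
Qed.

Lemma adj_pauli_mul n (a b a' b' : 'rV[F]_n) :
  adj (pauli a b) *m pauli a' b' =
  chi (- dot b (a' - a)) *: pauli (a' - a) (b' - b).
Proof.
apply/matrixP => i j; rewrite !mxE.
pose g s := (if s == label i + a then chi (- dot b (label i)) else 0) *
  chi (dot b' (label j)).
rewrite (eq_bigr (fun s => if label s == label j + a' then g (label s) else 0)).
  rewrite sum_label_eq /g.
  have -> : (label j + a' == label i + a) = (label i == label j + (a' - a)).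
    by rewrite addrA eq_sym [RHS]eq_sym subr_eq eq_sym.
  case: eqP => [->|_]; last by rewrite mul0r mulr0.
  by rewrite -!add_charD dotDr dotDl dotNl; congr (chi _); ring.
move=> s _; rewrite adjE !mxE /g; case: eqP => [->|_]; case: eqP => _;
  by rewrite -?add_charN ?conjc0 ?mul0r ?mulr0.
Qed.

(* Fourier inversion on [F] *)
Lemma delta_mx_site_pauli i j : delta_mx i j =
  \sum_y (#|F|%:R^-1 * chi (- (y * e j))) *: site_pauli (e i - e j) y.
Proof.
have card_F_neq0 : #|F|%:R != 0 :> C.
  by rewrite pnatr_eq0 -lt0n ltnW ?card_finNzRing_gt1.
apply/matrixP => k l; rewrite summxE !mxE; under eq_bigr do rewrite !mxE.
have -> : (e k == e l + (e i - e j)) = (e k - e i == e l - e j).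
  by rewrite subr_eq [in RHS]addrAC addrA.
have [kl|kl] := eqVneq (e k - e i) (e l - e j); last first.
  rewrite big1 => [|y _]; last by rewrite mulr0.
  by case: andP => // -[/eqP ki /eqP lj]; rewrite ki lj !subrr eqxx in kl.
have -> : (k == i) = (l == j).
  by rewrite -[LHS](bij_eq e_bij) -subr_eq0 kl subr_eq0 (bij_eq e_bij).
under eq_bigr do
  rewrite -mulrA -add_charD -mulrN -mulrDr addrC mulrC [_ * (_ - _)]mulrC.
rewrite -mulr_suml sum_char_mul subr_eq0 (bij_eq e_bij).
by case: eqP => _; rewrite ?mul0r // mul1n mulfV.
Qed.

Lemma site_pauli_span A : A \in (\sum_p <[site_pauli p.1 p.2]>)%VS.
Proof.
rewrite (matrix_sum_delta A); apply: memv_suml => i _; apply: memv_suml => j _.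
rewrite memvZ // delta_mx_site_pauli; apply: memv_suml => y _; rewrite memvZ //.
exact: (memv_sum_lines (fun p => site_pauli p.1 p.2) (i := (_, _))).
Qed.

Lemma local_op_pauli n j (K : 'M[C]_(pw d n)) : local_op j K ->
  K \in (\sum_(p | (wt p.1 p.2 <= j)%N) <[pauli p.1 p.2]>)%VS.
Proof.
have mem_pauli n' w (a b : 'rV[F]_n') : (wt a b <= w)%N ->
    pauli a b \in (\sum_(p | (wt p.1 p.2 <= w)%N) <[pauli p.1 p.2]>)%VS.
  exact: (memv_sum_lines (fun p => pauli p.1 p.2) (i := (a, b))).
elim=> {n j K} [j|n j K _ IHK|n j A K _ IHK].
- by rewrite -pauli00; apply: mem_pauli; rewrite wt0.
- apply: (tensmx_sum_lines (P := pred1 (0, 0)) (A := fun p => site_pauli p.1 p.2)) IHK.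
    move=> _ [a b] /eqP-> wt_ab; rewrite pauli_tens; apply: (mem_pauli n.+1).
    by rewrite wt_rVcons eqxx.
  by rewrite big_pred1_eq /= site_pauli00 memv_line.
- apply: tensmx_sum_lines (site_pauli_span A) IHK => -[x y] [a b] _ wt_ab.
  rewrite pauli_tens; apply: (mem_pauli n.+1); rewrite wt_rVcons.
  exact: leq_add (leq_b1 _) wt_ab.
Qed.

Lemma pauli_matrix_element n (a b : 'rV[F]_n) M M' (V : 'M[C]_(pw d n, M))
    (V' : 'M[C]_(pw d n, M')) m m' (f f' : 'rV[F]_n -> C) :
    (forall i, V i m = f (label i)) -> (forall i, V' i m' = f' (label i)) ->
  (adj V' *m pauli a b *m V) m' m =
  \sum_y conjc (f' (y + a)) * (chi (dot b y) * f y).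
Proof.
move=> Vf V'f'; rewrite mxE.
rewrite -(sum_label (fun y => conjc (f' (y + a)) * (chi (dot b y) * f y))).
apply: eq_bigr => j _; rewrite Vf mulrA; congr (_ * _); rewrite mxE.
rewrite (eq_bigr (fun i => if label i == label j + a
    then conjc (f' (label i)) * chi (dot b (label j)) else 0)) => [|i _].
  exact: (sum_label_eq (fun y => conjc (f' y) * chi (dot b (label j)))).
by rewrite adjE V'f' mxE; case: eqP => _ //; rewrite mulr0.
Qed.

Definition nondegenerate n M w (V : 'M[C]_(pw d n, M)) : Prop :=
  forall a b : 'rV[F]_n, (wt a b <= w)%N ->
    adj V *m pauli a b *m V = ((a == 0) && (b == 0))%:R%:M.

Lemma nondegenerate_isometric n M w (V : 'M[C]_(pw d n, M)) :
  nondegenerate w V -> isometric V.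
Proof. by move=> /(_ 0 0); rewrite wt0 pauli00 mulmx1 !eqxx; exact. Qed.

Section NondegenerateCode.
Variables (n m f : nat) (V : 'M[C]_(pw d n, m.+1)).

Definition corrupted_code (p : {p : 'rV[F]_n * 'rV[F]_n | (wt p.1 p.2 <= f)%N}) :
  'M[C]_(pw d n, m.+1) := pauli (val p).1 (val p).2 *m V.

Lemma corrupted_code_orthogonal :
  nondegenerate f.*2 V -> orthogonal_isometries corrupted_code.
Proof.
move=> codeV [[a b] /= wt_ab] [[a' b'] /= wt_ab'].
rewrite /corrupted_code -val_eqE /= xpair_eqE.
rewrite adjM mulmxA -[adj V *m _ *m _]mulmxA adj_pauli_mul -scalemxAr -scalemxAl.
rewrite codeV; last by rewrite (leq_trans (wtB _ _ _ _)) // -addnn leq_add.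
rewrite !subr_eq0 [a' == a]eq_sym [b' == b]eq_sym.
case: andP => [[/eqP-> _]|_]; last by rewrite raddf0 scaler0.
by rewrite subrr dotC dot0l oppr0 add_char0 scale1r.
Qed.

Lemma local_op_corrupted_code j (K : 'M[C]_(pw d n)) : (j <= f)%N -> local_op j K ->
  K *m V \in (\sum_p <[corrupted_code p]>)%VS.
Proof.
move=> le_jf /local_op_pauli/sum_lines_coords[c ->]; rewrite mulmx_suml.
apply: memv_suml => -[a b] /= wt_ab; rewrite -scalemxAl memvZ //.
pose p : {p : 'rV[F]_n * 'rV[F]_n | (wt p.1 p.2 <= f)%N} :=
  exist _ (a, b) (leq_trans wt_ab le_jf).
exact: (memv_sum_lines corrupted_code (i := p)).
Qed.

Lemma Delta_tpow_nondegenerate (T : 'M[C]_d -> 'M[C]_d)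
    (L : {linear 'M[C]_d -> 'M[C]_d}) (delta : R) :
    T =1 idfun \+ L -> L 1%:M = 0 -> 0 <= delta -> cbnorm_le L delta ->
    nondegenerate f.*2 V ->
  (Delta (tpow T (n := n)) m.+1 <= (binomial_tail n f delta)%:E)%E.
Proof.
move=> TE L1 delta_ge0 leL codeV.
apply: (Delta_tpow_code TE L1 delta_ge0 leL (corrupted_code_orthogonal codeV)) => [|j K].
  exact: nondegenerate_isometric codeV.
exact: local_op_corrupted_code.
Qed.

End NondegenerateCode.

Section GraphCode.
Variables (k n M : nat) (G : 'M[F]_(k + n)) (iota : 'I_M -> 'rV[F]_k).
Hypothesis iota_inj : injective iota.

Definition code_scale : C := (Num.sqrt (#|F| ^ n)%:R)^-1%:C%C.

Lemma sqr_code_scale : code_scale ^+ 2 * (#|F| ^ n)%:R = 1.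
Proof.
rewrite -rmorphXn /= exprVn sqr_sqrtr ?ler0n // -(rmorph_nat (real_complex R)).
by rewrite -rmorphM mulVf // pnatr_eq0 -lt0n expn_gt0 ltnW ?card_finNzRing_gt1.
Qed.

Definition graph_code : 'M[C]_(pw d n, M) :=
  \matrix_(i, m) (code_scale * chi (qform G (row_mx (iota m) (label i)))).

Lemma graph_code_pauliE a b m' m :
  let u := row_mx (iota m' - iota m) a in
  (adj graph_code *m pauli a b *m graph_code) m' m =
  chi (- qform G u - dot (lsubmx (u *m (G + G^T))) (iota m)) *
    (b == connecting_phase G u)%:R.
Proof.
move=> u; set nu := code_scale; pose word m y := nu * chi (qform G (row_mx (iota m) y)).
have conj_word l y : conjc (word l y) = nu * chi (- qform G (row_mx (iota l) y)).
  by rewrite rmorphM add_charN; congr (_ * _); exact: conjc_real.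
have codeE l i : graph_code i l = word l (label i) by rewrite mxE.
rewrite (pauli_matrix_element a b (codeE m) (codeE m')).
set x := iota m; set c := - _ - _.
have overlap y :
    nu * chi (- qform G (row_mx (iota m') (y + a))) * (chi (dot b y) * word m y) =
    nu ^+ 2 * chi c * chi (dot (b - connecting_phase G u) y).
  have -> : row_mx (iota m') (y + a) = row_mx x y + u.
    by rewrite /u add_row_mx addrCA subrr addr0.
  rewrite [X in _ * X]mulrCA mulrACA -expr2 -mulrA -!add_charD; congr (_ * chi _).
  rewrite qformD dotDl dotNl /c.
  have -> : dot (u *m (G + G^T)) (row_mx x y) =
      dot (lsubmx (u *m (G + G^T))) x + dot (connecting_phase G u) y.
    by rewrite -dot_row hsubmxK.
  by ring.
under eq_bigr do rewrite conj_word overlap.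
rewrite -mulr_sumr sum_char_dot subr_eq0 natrM -mulrA.
by rewrite mulrCA [X in _ * X]mulrCA sqr_code_scale mulr1.
Qed.

Lemma graph_code_nondegenerate w : good_graph G w -> nondegenerate w graph_code.
Proof.
move=> goodG a b wt_ab; apply/matrixP => m' m; rewrite graph_code_pauliE mxE.
set u := row_mx _ a; have phase0 : connecting_phase G 0 = 0.
  by rewrite /connecting_phase mul0mx linear0.
have [b_phase|b_phase] := eqVneq b (connecting_phase G u).
  have u0 := goodG _ _ _ wt_ab b_phase; rewrite -/u in u0.
  have /andP[/eqP iotaE /eqP->] : (iota m' - iota m == 0) && (a == 0).
    by rewrite -row_mx_eq0 -/u u0.
  have -> : m' = m by apply/iota_inj/eqP; rewrite -subr_eq0 iotaE.
  rewrite b_phase u0 phase0 !eqxx mulr1 /qform !mul0mx dot0l oppr0 add0r.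
  by rewrite linear0 dot0l oppr0 add_char0.
rewrite mulr0; have [m'E|] := eqVneq m' m; last by rewrite mulr0n.
case: andP => [[/eqP a0 /eqP b0]|//]; case/eqP: b_phase.
by rewrite b0 /u a0 m'E subrr row_mx0 phase0.
Qed.

End GraphCode.

End Pauli.

(** * Existence of good graphs *)

Lemma card_fiber_le (U V : finZmodType) (W : finType) (phi : U -> V) (E : W -> U) v :
    {morph phi : x y / x + y} -> injective (phi \o E) ->
  (#|[set x | v == phi x]| * #|W| <= #|U|)%N.
Proof.
move=> phiD injE; rewrite -[#|W|]cardsT -cardsX.
rewrite -(@card_in_imset _ _ (fun p => p.1 + E p.2)) ?max_card //.
move=> [x w] [x' w']; rewrite !inE !andbT /= => /eqP vx /eqP vx' eq_sum.
have ww' : w = w'.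
  by apply: injE; move/(congr1 phi): eq_sum; rewrite !phiD -vx -vx' => /addrI.
by move: eq_sum; rewrite ww' => /addIr ->.
Qed.

Lemma card_bigcup_le (I T : finType) (A : {set I}) (B : I -> {set T}) :
  (#|\bigcup_(i in A) B i| <= \sum_(i in A) #|B i|)%N.
Proof.
apply: (big_ind2 (fun (S : {set T}) m => #|S| <= m)%N) => // [|S m S' m' leS leS'].
  by rewrite cards0.
by rewrite cardsU (leq_trans (leq_subr _ _)) // leq_add.
Qed.

Lemma exists_notin_all (I T : finType) (A : {set I}) (B : I -> {set T}) q :
    (0 < #|T|)%N -> (forall i, i \in A -> #|B i| * q <= #|T|)%N -> (#|A| < q)%N ->
  exists x, forall i, i \in A -> x \notin B i.
Proof.
move=> T_gt0 leB ltA; pose U := \bigcup_(i in A) B i.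
have ltU : (#|U| < #|T|)%N.
  rewrite -(ltn_pmul2r (leq_ltn_trans (leq0n _) ltA)).
  apply: (@leq_ltn_trans (#|A| * #|T|)); last by rewrite mulnC ltn_pmul2l.
  apply: leq_trans (leq_mul (card_bigcup_le A B) (leqnn q)) _.
  by rewrite big_distrl /= -sum_nat_const; exact: leq_sum.
have /subsetPn[x _ xU] : ~~ ([set: T] \subset U).
  by apply: contraL ltU => /subset_leq_card; rewrite cardsT -leqNgt.
by exists x => i Ai; apply: contra xU => xB; apply/bigcupP; exists i.
Qed.

Lemma connecting_phaseD (F : comNzRingType) k n (z : 'rV[F]_(k + n)) :
  {morph (fun G => connecting_phase G z) : G H / G + H}.
Proof.
move=> G H; rewrite /connecting_phase [(G + H)^T]linearD addrACA mulmxDr.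
exact: linearD.
Qed.

Section GilbertVarshamov.
Variables (F : finFieldType) (k n : nat).
Local Notation q := #|F|.

(* Adding [(u v)^T e_i] and its transpose to the graph changes the coordinates of
   [z (G + G^T)] other than [i] by [z_i (u v)]; at least [n] of them are outputs. *)
Lemma connecting_phase_shift (z : 'rV[F]_(k + n.+1)) : z != 0 ->
  exists E : 'rV[F]_n -> 'M[F]_(k + n.+1), injective (fun v => connecting_phase (E v) z).
Proof.
move=> /rV0Pn[i z_i].
pose i0 := if fintype.split i is inr i0 then i0 else ord0.
have lift_neq_i l : rshift k (lift i0 l) != i.
  rewrite /i0; case: split_ordP => j ->; rewrite ?eq_rlshift //.
  by rewrite eq_rshift eq_sym neq_lift.
pose u (v : 'rV[F]_n) : 'rV[F]_(k + n.+1) :=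
  row_mx 0 (\row_j if unlift i0 j is Some l then v 0 l else 0).
pose E v : 'M[F]_(k + n.+1) := (u v)^T *m delta_mx 0 i.
exists E => v v' /matrixP eq_phase; apply/matrixP => a l; rewrite ord1.
have phaseE w : connecting_phase (E w) z 0 (lift i0 l) = z 0 i * w 0 l.
  rewrite mxE mulmxDr mxE [X in X + _](_ : _ = 0); last first.
    rewrite /E mulmxA mxE big1 // => j _.
    by rewrite [delta_mx _ _ _ _]mxE (negbTE (lift_neq_i l)) andbF mulr0.
  rewrite add0r /E trmx_mul trmxK trmx_delta mulmxA mxE big_ord1.
  by rewrite -colE mxE /u row_mxEr mxE liftK.
by apply: (mulfI z_i); rewrite -!phaseE eq_phase.
Qed.

Lemma card_connecting_phase_le (z : 'rV[F]_(k + n.+1)) b : z != 0 ->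
  (#|[set G | b == connecting_phase G z]| * q ^ n <= #|{: 'M[F]_(k + n.+1)}|)%N.
Proof.
move=> /connecting_phase_shift[E injE].
have -> : (q ^ n)%N = #|{: 'rV[F]_n}| by rewrite card_mx mul1n.
exact: card_fiber_le (connecting_phaseD z) injE.
Qed.

Lemma good_graph_exists w : (q ^ k * #|wt_ball F n.+1 w| < q ^ n)%N ->
  exists G : 'M[F]_(k + n.+1), good_graph G w.
Proof.
move=> few_paulis.
pose A := [set t : 'rV[F]_k * ('rV[F]_n.+1 * 'rV[F]_n.+1) |
  (wt t.2.1 t.2.2 <= w)%N && (row_mx t.1 t.2.1 != 0)].
pose bad (t : 'rV[F]_k * ('rV[F]_n.+1 * 'rV[F]_n.+1)) :=
  [set G | t.2.2 == connecting_phase G (row_mx t.1 t.2.1)].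
have [|t||G goodG] := @exists_notin_all _ _ A bad (q ^ n).
- by apply/card_gt0P; exists 0.
- by rewrite inE => /andP[_]; exact: card_connecting_phase_le.
- apply: leq_ltn_trans few_paulis.
  have -> : (q ^ k)%N = #|[set: 'rV[F]_k]| by rewrite cardsT card_mx mul1n.
  rewrite -cardsX; apply: subset_leq_card; apply/fintype.subsetP => -[x [a b]].
  by rewrite !inE => /andP[].
exists G => x a b wt_ab bE; apply/eqP/negPn/negP => xa_neq0.
by have := goodG (x, (a, b)); rewrite !inE /= wt_ab xa_neq0 bE eqxx => /(_ isT).
Qed.

End GilbertVarshamov.

Section PauliCount.
Variables (F : finNzRingType) (n : nat).

Lemma sum_expr_wt (R : comNzRingType) (t : R) :
  \sum_(p : 'rV[F]_n * 'rV[F]_n) t ^+ wt p.1 p.2 = (1 + (#|F| ^ 2).-1%:R * t) ^+ n.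
Proof.
pose to_rows (f : {ffun 'I_n -> F * F}) : 'rV[F]_n * 'rV[F]_n :=
  (\row_i (f i).1, \row_i (f i).2).
have to_rows_bij : bijective to_rows.
  exists (fun p : 'rV[F]_n * 'rV[F]_n => [ffun i => (p.1 0 i, p.2 0 i)]) => [f|[a b]].
    by apply/ffunP => i; rewrite ffunE !mxE -surjective_pairing.
  by congr (_, _); apply/matrixP => i j; rewrite mxE ffunE ord1.
rewrite (reindex to_rows) /=; last exact: onW_bij.
pose site_weight (p : F * F) := t ^+ ((p.1 != 0%R) || (p.2 != 0%R)).
rewrite (eq_bigr (fun f : {ffun 'I_n -> F * F} => \prod_i site_weight (f i))) => [|f _];
    last first.
  by rewrite /wt expr_sum; apply: eq_bigr => i _; rewrite !mxE.
rewrite -(bigA_distr_bigA (fun=> site_weight)) prodr_const card_ord; congr (_ ^+ _).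
rewrite (bigD1 (0, 0)) //= /site_weight eqxx expr0; congr (_ + _).
rewrite (eq_bigr (fun=> t)) => [|[x y]].
  rewrite sumr_const mulr_natl; congr (_ *+ _).
  by rewrite cardC1 card_prod mulnn.
by rewrite xpair_eqE negb_and /= => ->.
Qed.

Lemma count_wt_le (R : realDomainType) w (t : R) : 0 < t <= 1 ->
  #|wt_ball F n w|%:R * t ^+ w <= (1 + (#|F| ^ 2).-1%:R * t) ^+ n.
Proof.
move=> /andP[t0 t1]; rewrite -sum_expr_wt.
rewrite [leRHS](bigID (fun p => (wt p.1 p.2 <= w)%N)) /= -[leLHS]addr0 lerD //.
  rewrite mulr_natl -sumr_const big_set.
  by apply: ler_sum => p wt_p; apply: ler_wiXn2l => //; exact: ltW.
by apply: sumr_ge0 => p _; rewrite exprn_ge0 // ltW.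
Qed.

End PauliCount.

Lemma Delta_tpow_graph_code (R : realType) d (T : 'M[R[i]]_d -> 'M[R[i]]_d)
    (L : {linear 'M[R[i]]_d -> 'M[R[i]]_d}) (delta : R) n k m f :
    prime d -> T =1 idfun \+ L -> L 1%:M = 0 -> 0 <= delta -> cbnorm_le L delta ->
    (m < d ^ k)%N ->
    (d ^ k * #|wt_ball 'F_d n.+1 f.*2| < d ^ n)%N ->
  (Delta (tpow T (n := n.+1)) m.+1 <= (binomial_tail n.+1 f delta)%:E)%E.
Proof.
move=> d_prime TE L1 delta_ge0 leL lt_m few_paulis.
have card_Fd : #|'F_d| = d by exact: card_Fp.
pose e (i : 'I_d) : 'F_d := enum_val (cast_ord (esym card_Fd) i).
have e_bij : bijective e.
  apply: (bij_comp (@enum_val_bij 'F_d)); exists (cast_ord card_Fd).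
    exact: cast_ordKV.
  exact: cast_ordK.
have [|G goodG] := @good_graph_exists 'F_d k n f.*2; first by rewrite card_Fd.
have lt_mk : (m < #|{: 'rV['F_d]_k}|)%N by rewrite card_mx mul1n card_Fd.
pose iota (i : 'I_m.+1) : 'rV['F_d]_k := enum_val (widen_ord lt_mk i).
have iota_inj : injective iota by move=> i j /enum_val_inj[/val_inj].
have chi := add_char_Fp R d_prime.
apply: (Delta_tpow_nondegenerate (chi := chi) e_bij TE L1 delta_ge0 leL).
exact: (graph_code_nondegenerate chi e_bij iota_inj goodG).
Qed.

(** * Asymptotics *)

Section Entropy.
Variable R : realType.
Implicit Types eps p c delta : R.

Lemma powR2E (x : R) : 2 `^ x = expR (x * ln 2).
Proof. by rewrite /powR pnatr_eq0. Qed.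

Lemma ln2_gt0 : 0 < ln 2 :> R.
Proof. by rewrite ln_gt0 // ltr1n. Qed.

Lemma H2_ln2 p : H2 p * ln 2 = - p * ln p - (1 - p) * ln (1 - p).
Proof. by rewrite /H2 /log2; field; rewrite gt_eqF ?ln2_gt0. Qed.

Lemma H2_ge0 p : 0 <= p <= 1 -> 0 <= H2 p.
Proof.
move=> /andP[p0 p1]; rewrite -(pmulr_lge0 _ ln2_gt0) H2_ln2.
have lnp : ln p <= 0 by exact: ln_le0.
have ln1p : ln (1 - p) <= 0 by apply: ln_le0; lra.
nra.
Qed.

(* This is [eps (1 - eps) ^ ((1 - eps) / eps)]. *)
Definition gv_threshold eps : R := 2 `^ (- H2 eps / eps).

Lemma gv_threshold_expr_le eps n j : 0 < eps < 1 -> (j <= n)%N -> eps * n%:R <= j%:R ->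
  gv_threshold eps ^+ j <= eps ^+ j * (1 - eps) ^+ (n - j).
Proof.
move=> /andP[e0 e1] le_jn le_nj; have e1' : 0 < 1 - eps by rewrite subr_gt0.
rewrite /gv_threshold powR2E -expRM_natl -[X in X ^+ j * _](@lnK R) ?posrE // -expRM_natl.
rewrite -[X in _ * X ^+ _](@lnK R) ?posrE // -expRM_natl -expRD ler_expR.
have -> : - H2 eps / eps * ln 2 = ln eps + (1 - eps) / eps * ln (1 - eps).
  by rewrite mulrAC mulNr H2_ln2; field; rewrite gt_eqF.
rewrite mulrDr lerD2l mulrA ler_wnM2r //; first by apply: ln_le0; lra.
by rewrite natrB // mulrA ler_pdivlMr //; nra.
Qed.

Lemma binomial_tail_le eps delta n f : 0 < eps < 1 -> 0 <= delta ->
    delta <= gv_threshold eps -> eps * n%:R <= f.+1%:R ->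
  binomial_tail n f delta <= (delta / gv_threshold eps) ^+ f.+1.
Proof.
move=> /andP[e0 e1] delta_ge0; set delta0 := gv_threshold _ => le_delta le_nf.
have delta0_gt0 : 0 < delta0 by rewrite powR_gt0.
set mu := delta / delta0.
have mu_ge0 : 0 <= mu by rewrite divr_ge0 // ltW.
have mu_le1 : mu <= 1 by rewrite ler_pdivrMr // mul1r.
pose binomial_prob (j : 'I_n.+1) := 'C(n, j)%:R * (eps ^+ j * (1 - eps) ^+ (n - j)).
have prob_ge0 j : 0 <= binomial_prob j.
  by rewrite mulr_ge0 // mulr_ge0 // exprn_ge0 ?subr_ge0 // ltW.
have total_prob : \sum_j binomial_prob j = 1.
  rewrite -[RHS](expr1n _ n) -[X in _ = X ^+ n](subrK eps) exprDn.
  by apply: eq_bigr => j _; rewrite /binomial_prob mulr_natl [eps ^+ j * _]mulrC.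
apply: (@le_trans _ _ (mu ^+ f.+1 * \sum_(j < n.+1 | (f < j)%N) binomial_prob j)).
  rewrite mulr_sumr; apply: ler_sum => j lt_fj; rewrite mulrCA ler_wpM2l //.
  rewrite -[delta](@divfK _ delta0) ?gt_eqF // exprMn.
  apply: ler_pM; rewrite ?exprn_ge0 ?(ltW delta0_gt0) //; first exact: ler_wiXn2l.
  apply: gv_threshold_expr_le; [by rewrite e0|by rewrite -ltnS ltn_ord|].
  by apply: le_trans le_nf _; rewrite ler_nat.
rewrite ler_piMr ?exprn_ge0 // -total_prob.
rewrite [leRHS](bigID (fun j : 'I_n.+1 => (f < j)%N)) /= lerDl.
exact: sumr_ge0.
Qed.

Lemma count_wt_entropy_le (F : finFieldType) n w p : 0 < p <= 1 / 2 ->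
    w%:R <= p * n%:R ->
  #|wt_ball F n w|%:R <=
  expR (n%:R * (2 * p * ln #|F|%:R + H2 p * ln 2)).
Proof.
move=> /andP[p0 p2] le_wn; set q : R := #|F|%:R.
have q1 : 1 <= q by rewrite ler1n ltnW ?card_finNzRing_gt1.
have q0 : 0 < q by exact: lt_le_trans q1.
have p1 : 0 < 1 - p by lra.
(* Up to replacing [q ^ 2 - 1] by [q ^ 2], this minimizes the bound of [count_wt_le]. *)
pose t := p / ((1 - p) * q ^+ 2).
have t0 : 0 < t by rewrite divr_gt0 // mulr_gt0 // exprn_gt0.
have t1 : t <= 1.
  rewrite ler_pdivrMr ?mul1r; last by rewrite mulr_gt0 // exprn_gt0.
  have : 1 <= q ^+ 2 by rewrite exprn_ege1.
  nra.
have base_le : 1 + (#|F| ^ 2).-1%:R * t <= (1 - p)^-1.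
  have -> : (1 - p)^-1 = 1 + q ^+ 2 * t by rewrite /t; field; rewrite !gt_eqF.
  by rewrite lerD2l ler_wpM2r ?(ltW t0) // -natrX ler_nat leq_pred.
have := @count_wt_le F n R w t; rewrite t0 t1 => /(_ isT).
rewrite -ler_pdivlMr ?exprn_gt0 // => /le_trans; apply.
apply: (@le_trans _ _ ((1 - p)^-1 ^+ n / t ^+ w)).
  rewrite ler_wpM2r ?invr_ge0 ?exprn_ge0 ?(ltW t0) //.
  by rewrite lerXn2r ?nnegrE ?invr_ge0 ?(ltW p1) // addr_ge0 // mulr_ge0 // ltW.
have lnt : ln t = ln p - ln (1 - p) - 2 * ln q.
  rewrite /t ln_div ?posrE ?mulr_gt0 ?exprn_gt0 // lnM ?posrE ?exprn_gt0 //.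
  by rewrite lnXn // -mulr_natl; ring.
have lnt_le0 : ln p - ln (1 - p) - 2 * ln q <= 0 by rewrite -lnt ln_le0.
rewrite -[t](@lnK R) ?posrE // -expRM_natl -[(1 - p)^-1](@lnK R) ?posrE ?invr_gt0 //.
rewrite -expRM_natl -expRB ler_expR lnV ?posrE // H2_ln2 lnt.
have := ler_wnM2r lnt_le0 le_wn; nra.
Qed.

Lemma expn_between (d m : nat) : (1 < d)%N -> exists k, (m < d ^ k <= d * m.+1)%N.
Proof.
move=> d1; case: m => [|m]; first by exists 0%N; rewrite expn0 muln1 (ltnW d1).
exists (up_log d m.+2); have /andP[lt_k ->] := up_log_bounds d1 (isT : (1 < m.+2)%N).
have k0 : (0 < up_log d m.+2)%N by rewrite up_log_gt0 d1.
by rewrite -(prednK k0) expnS leq_mul2l ltnW ?orbT.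
Qed.

Definition gv_rate (q : nat) eps : R := (1 - 4 * eps) * log2 q%:R - H2 (2 * eps).

Lemma gv_rate_gt0_lt_quarter (q : nat) eps : (1 < q)%N -> 0 < eps < 1 / 2 ->
  0 < gv_rate q eps -> eps < 1 / 4.
Proof.
move=> q1 /andP[e0 e2]; rewrite /gv_rate; have H0 : 0 <= H2 (2 * eps).
  by apply: H2_ge0; apply/andP; split; lra.
have log_gt0 : 0 < log2 q%:R :> R by rewrite divr_gt0 ?ln2_gt0 // ln_gt0 // ltr1n.
by rewrite ltNge => rate_gt0; apply/negP => e4; nra.
Qed.

Lemma gv_counting (F : finFieldType) n k m f eps c : 0 < eps <= 1 / 4 ->
    (#|F| ^ k <= #|F| * m.+1)%N -> m.+1%:R <= 2 `^ (c * n.+1%:R) ->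
    f%:R <= eps * n.+1%:R ->
    2 * ln #|F|%:R < n.+1%:R * ((gv_rate #|F| eps - c) * ln 2) ->
  (#|F| ^ k * #|wt_ball F n.+1 f.*2| < #|F| ^ n)%N.
Proof.
move=> /andP[e0 e4] le_k le_m le_f large_n.
have q_gt0 : 0 < #|F|%:R :> R by rewrite ltr0n ltnW ?card_finNzRing_gt1.
have count_le := @count_wt_entropy_le F n.+1 f.*2 (2 * eps).
rewrite -(ltr_nat R) natrM natrX.
apply: (@le_lt_trans _ _ (expR (ln #|F|%:R) * expR (c * n.+1%:R * ln 2) *
  expR (n.+1%:R * (2 * (2 * eps) * ln #|F|%:R + H2 (2 * eps) * ln 2)))).
  apply: ler_pM => //.
    rewrite lnK ?posrE //; apply: (@le_trans _ _ (#|F|%:R * m.+1%:R)).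
      by rewrite -natrX -natrM ler_nat.
    by rewrite ler_pM2l // -powR2E.
  apply: count_le; first by apply/andP; split; lra.
  by rewrite -mul2n natrM -mulrA ler_pM2l.
rewrite natrX -[X in _ < X ^+ n](@lnK R) ?posrE // -expRM_natl -!expRD ltr_expR.
move: large_n; rewrite -(natr1 n); set l := ln #|F|%:R; set x := n%:R.
have -> : (gv_rate #|F| eps - c) * ln 2 =
    (1 - 4 * eps) * l - H2 (2 * eps) * ln 2 - c * ln 2.
  by rewrite /gv_rate /log2 -/l; field; rewrite gt_eqF ?ln2_gt0.
by set h := H2 (2 * eps); set z := ln 2; nra.
Qed.

Lemma cvg_geometric_truncn (mu eps : R) : 0 <= mu < 1 -> 0 < eps ->
  ((fun n : nat => mu ^+ (Num.truncn (eps * n%:R)).+1) @ \oo --> 0)%classic.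
Proof.
move=> /andP[mu0 mu1] e0.
have truncn_infty : ((fun n => (Num.truncn (eps * n%:R)).+1) @ \oo --> \oo)%classic.
  apply/cvgnyPge => A; near=> n.
  rewrite ltnW // ltnS truncn_ge_nat; last by rewrite mulr_ge0 // ltW.
  by rewrite mulrC -ler_pdivrMr //; near: n; exact: nbhs_infty_ger.
by apply: (cvg_comp _ _ truncn_infty); apply: cvg_expr; rewrite ger0_norm.
Unshelve. all: by end_near.
Qed.

End Entropy.

Section Achievability.
Variables (R : realType) (d : nat) (T : 'M[R[i]]_d -> 'M[R[i]]_d).
Variables (L : {linear 'M[R[i]]_d -> 'M[R[i]]_d}) (delta : R).
Hypothesis d_prime : prime d.
Hypothesis T_decomp : T =1 idfun \+ L.
Hypothesis L1 : L 1%:M = 0.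

Lemma achievable0 : achievable T 0.
Proof.
split=> //; rewrite (_ : (fun n => _) = cst 0%E); first exact: cvg_cst.
apply/funext => n; rewrite mul0r powRr0 truncn1; apply: Delta_dim1.
  by elim: n => //= n IHn; rewrite muln_gt0 prime_gt0.
by move=> c; exact: tpow_scalar T_decomp L1 n c.
Qed.

Hypothesis delta_ge0 : 0 <= delta.
Hypothesis leL : cbnorm_le L delta.

Lemma Delta_tpow_rate_le n eps c : 0 < eps < 1 / 2 ->
    delta <= gv_threshold eps -> 0 <= c < gv_rate d eps ->
    2 * ln d%:R < n.+1%:R * ((gv_rate d eps - c) * ln 2) ->
  (Delta (tpow T (n := n.+1)) (Num.truncn (2 `^ (c * n.+1%:R))) <=
    ((delta / gv_threshold eps) ^+ (Num.truncn (eps * n.+1%:R)).+1)%:E)%E.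
Proof.
move=> eps_bounds le_delta /andP[c0 lt_c] large_n.
have d1 := prime_gt1 d_prime; have /andP[e0 e2] := eps_bounds.
have e4 := gv_rate_gt0_lt_quarter d1 eps_bounds (le_lt_trans c0 lt_c).
have M_gt0 : (0 < Num.truncn (2 `^ (c * n.+1%:R) : R))%N.
  by rewrite truncn_gt0 powR2E -[leLHS]expR0 ler_expR !mulr_ge0 // ltW ?ln2_gt0.
have le_M : (Num.truncn (2 `^ (c * n.+1%:R) : R))%:R <= 2 `^ (c * n.+1%:R) :> R.
  by rewrite truncn_le powR_ge0.
case: (Num.truncn _) M_gt0 le_M => // m _ le_m.
have [k /andP[lt_mk le_k]] := expn_between m d1.
have le_f : (Num.truncn (eps * n.+1%:R))%:R <= eps * n.+1%:R.
  by rewrite truncn_le mulr_ge0 // ltW.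
have few := @gv_counting R 'F_d n k m _ eps c _ _ le_m le_f.
rewrite card_Fp // e0 (ltW e4) in few.
apply: le_trans
  (Delta_tpow_graph_code d_prime T_decomp L1 delta_ge0 leL lt_mk (few _ _ _)) _ => //.
rewrite lee_fin; apply: binomial_tail_le => //; first by rewrite e0; lra.
exact/ltW/truncnS_gt.
Qed.

Lemma achievable_lt_gv_rate eps c : 0 < eps < 1 / 2 ->
    delta < gv_threshold eps -> 0 <= c < gv_rate d eps ->
  achievable T c.
Proof.
move=> eps_bounds lt_delta c_bounds; have /andP[c0 lt_c] := c_bounds.
have /andP[e0 _] := eps_bounds; split=> //.
have gap : 0 < (gv_rate d eps - c) * ln 2 by rewrite mulr_gt0 ?subr_gt0 ?ln2_gt0.
pose mu := delta / gv_threshold eps.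
have mu_bounds : 0 <= mu < 1.
  by rewrite divr_ge0 ?powR_ge0 // ltr_pdivrMr ?powR_gt0 // mul1r.
apply: (@squeeze_cvge _ _ _ _ (cst 0%E) _
  (fun n => (mu ^+ (Num.truncn (eps * n%:R)).+1)%:E)); last 2 first.
- exact: cvg_cst.
- by apply: cvg_EFin; [near=> n|exact: cvg_geometric_truncn].
near=> n; rewrite Delta_ge0 /=.
have n0 : (0 < n)%N by near: n; exact: nbhs_infty_gt.
rewrite -(prednK n0); apply: Delta_tpow_rate_le (ltW lt_delta) c_bounds _ => //.
rewrite prednK // -ltr_pdivrMr //; near: n; exact: nbhs_infty_gtr.
Unshelve. all: by end_near.
Qed.

End Achievability.

Lemma channel_sub_id (R : realType) d (T : 'M[R[i]]_d -> 'M[R[i]]_d) (r : R) :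
    channel T -> (cbnorm (fun X => (X - T X)%R) < r%:E)%E ->
  exists (L : {linear 'M[R[i]]_d -> 'M[R[i]]_d}) (delta : R),
    [/\ T =1 idfun \+ L, L 1%:M = 0, 0 <= delta < r & cbnorm_le L delta].
Proof.
move=> [T_linear [T1 _]] lt_cb.
pose S X := X - T X; have S_linear : linear S.
  move=> c X Y; rewrite /S T_linear scalerBr opprD !addrA; congr (_ + _).
  exact: addrAC.
pose S' : {linear 'M[R[i]]_d -> 'M[R[i]]_d} :=
  HB.pack S (GRing.isLinear.Build _ _ _ _ S S_linear).
have cb_ge0 := cbnorm_ge0 S; have cb_fin : cbnorm S \is a fin_num.
  by rewrite ge0_fin_numE // (lt_trans lt_cb) // ltry.
exists (\- S'), (fine (cbnorm S)); split.
- by move=> X; rewrite /= /S opprB subrKC.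
- by rewrite /= /S T1 subrr oppr0.
- by rewrite fine_ge0 // -lte_fin fineK.
by apply/cbnorm_leN/(cbnorm_leP S'); rewrite ?fine_ge0 ?fineK.
Qed.

Theorem theorem1 (R : realType) (d : nat) (T : 'M[R[i]]_d -> 'M[R[i]]_d)
  (eps : R) :
  prime d -> channel T -> 0 < eps < 1 / 2 ->
  (cbnorm (fun X => (X - T X)%R) < (2 `^ (- H2 eps / eps))%:E)%E ->
  (((1 - 4 * eps) * log2 d%:R - H2 (2 * eps))%:E <= Qcap T)%E.
Proof.
move=> d_prime channelT eps_bounds /(channel_sub_id channelT).
move=> [L [delta [T_decomp L1 /andP[delta_ge0 lt_delta] leL]]].
have Qcap_ge c : achievable T c -> (c%:E <= Qcap T)%E.
  by move=> achievable_c; apply: ereal_sup_ubound; exists c.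
apply/lee_subgt0Pr => e e_gt0; rewrite -EFinB; set c := _ - e.
have [c_lt0|c_ge0] := ltP c 0.
  apply: le_trans (Qcap_ge 0 (achievable0 d_prime T_decomp L1)).
  by rewrite lee_fin ltW.
apply/Qcap_ge/(achievable_lt_gv_rate d_prime T_decomp L1 delta_ge0 leL eps_bounds) => //.
by rewrite c_ge0 /gv_rate ltrBlDr ltrDl.
Qed.
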